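(* Let $\Sigma\in\mathbb{R}^{d\times d}$ be positive definite, let $X_1,\dots,X_n$ be i.i.d. $\mathcal{N}(0,\Sigma)$, $W=\sum_{i=1}^nX_iX_i^\top$, and assume $d>n+1$. Then $$\mathbb{E}\,\mathrm{Tr}(W^\dagger)\le\frac{n}{d}\,\frac{\mathrm{Tr}(\Sigma^{-1})}{d-n-1},$$ where $W^\dagger$ is the Moore–Penrose pseudoinverse of $W$. *)

(* Defs.v *)
From HB Require Import structures.
From mathcomp Require Import all_boot all_order all_algebra.
From mathcomp Require Import all_classical all_reals all_analysis.
From mathcomp Require Import normal_distribution.

Set Implicit Arguments. Unset Strict Implicit. Unset Printing Implicit Defensive.
Import Order.TTheory GRing.Theory Num.Theory.
Local Open Scope classical_set_scope.
Local Open Scope ring_scope.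

Definition posdef (R : realType) (d : nat) (S : 'M[R]_d) : Prop :=
  S^T = S /\ forall x : 'cV[R]_d, x != 0 -> 0 < (x^T *m S *m x) ord0 ord0.

Definition is_MP_pinv (R : realType) (d : nat) (A B : 'M[R]_d) : Prop :=
  [/\ A *m B *m A = A, B *m A *m B = B, (A *m B)^T = A *m B & (B *m A)^T = B *m A].

(* Moore-Penrose pseudoinverse (exists and is unique for every real matrix). *)
Definition mp_pinv (R : realType) (d : nat) (A : 'M[R]_d) : 'M[R]_d :=
  xget 0 [set B | is_MP_pinv A B].

Definition rvec_measurable dT (T : measurableType dT) (R : realType) (d : nat)
    (X : T -> 'cV[R]_d) : Prop :=
  forall j : 'I_d, measurable_fun setT (fun t => X t j ord0).

(* X ~ N(0, S) (S positive definite): every nonzero linear functional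
   a^T X has law N(0, a^T S a) (normal_prob takes the standard deviation). *)
Definition gaussian_vec dT (T : measurableType dT) (R : realType)
    (P : probability T R) (d : nat) (X : T -> 'cV[R]_d) (S : 'M[R]_d) : Prop :=
  forall a : 'cV[R]_d, a != 0 ->
    forall B : set R, measurable B ->
      P ((fun t => (a^T *m X t) ord0 ord0) @^-1` B) =
      normal_prob 0 (Num.sqrt ((a^T *m S *m a) ord0 ord0)) B.

(* Mutual independence of random vectors X_1..X_n in R^d: the product rule
   on measurable rectangles (a pi-system generating the Borel sets of R^d). *)
Definition mutually_independent dT (T : measurableType dT) (R : realType)
    (P : probability T R) (n d : nat) (X : 'I_n -> T -> 'cV[R]_d) : Prop :=
  forall B : 'I_n -> 'I_d -> set R, (forall i j, measurable (B i j)) ->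
    forall I : {set 'I_n},
    P (\bigcap_(i in [set i | i \in I]) \bigcap_(j : 'I_d) ((fun t => X i t j ord0) @^-1` B i j)) =
    (\prod_(i in I) P (\bigcap_(j : 'I_d) ((fun t => X i t j ord0) @^-1` B i j)))%E.

Definition scatter (T : Type) (R : realType) (n d : nat) (X : 'I_n -> T -> 'cV[R]_d)
    (t : T) : 'M[R]_d :=
  \sum_(i < n) (X i t *m (X i t)^T).

(* Main.v *)
Require Import Defs.
From HB Require Import structures.
From mathcomp Require Import all_boot all_order all_algebra.
From mathcomp Require Import all_classical all_reals all_analysis.
From mathcomp Require Import normal_distribution measurable_realfun.
From mathcomp Require Import ring lra.
Import Order.TTheory GRing.Theory Num.Theory.
Import numFieldNormedType.Exports.
Local Open Scope classical_set_scope.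
Local Open Scope ring_scope.
Set Implicit Arguments.
Unset Strict Implicit.
Unset Printing Implicit Defensive.

(* Write [Sigma = A A^T] and [X_i = A Z_i] with [Z_i] standard Gaussian.  If [L]
   is a left inverse of [X = (X_1 ... X_n)], then [Tr W^+ = ||X^+||^2 <= ||L||^2].
   Take for [L] the rows [w_i^T A^-1], where [w_i = y_i / |y_i|^2] is dual to the
   [Z_k] and [y_i] is the residual of [Z_i] orthogonal to the other [Z_k]; then
   [||L||^2] is the sum over [i] and over the columns [v] of [A^-1] of
   [(v . w_i)^2].  Given the other vectors, with [Q] the projection orthogonal to
   them and [k = Tr Q], one has [E (v . w_i)^2 = |Q v|^2 / (k (k - 2))].  Along
   successive orthogonal projections [|P v|^2 / Tr P] has constant expectation
   [|v|^2 / d], so that [E (v . w_i)^2 <= |v|^2 / (d (d - n - 1))], and the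
   squared norms of the columns of [A^-1] add up to [Tr Sigma^-1].

   The law of a Gaussian vector is only known through its linear functionals.
   This suffices, because [exp (- s |y|^2)] is a Gaussian mixture of cosines of
   linear functionals, and negative powers of [|y|^2] are in turn mixtures of the
   [exp (- s |y|^2)]. *)

(** * Linear algebra *)

Section dot_product.
Context {R : realType}.

(** [L] is [Z^+ A^-1]. In general it differs from [X^+], because [A] distorts angles; comparing the
    norms of left inverses is what reduces the problem to the isotropic [Z_i]. The constant
    [1 / (k (k - 2))] is the share [1/k] of one coordinate times the mean [1 / (k - 2)] of [|y|^-2].
    Only [n - 1] vectors are projected out, so [k >= d - n + 1] and [k - 2] is bounded below by
    [d - n - 1]. The other [k] has to stay with [|Q v|^2]: bounding it separately would lose the
    factor [1/d]. With [s = (x^2 - 1) / 2] the mean of [exp (- s |y|^2)] is the integer power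
    [x^-k], so the integrals over [x] have elementary antiderivatives. The factor [(u . y)^2] is
    produced by changing [x] in the single direction [u], which is why every basis vector gets its
    own parameter. Conditioning on the other vectors is expressed as resampling one of them on a
    product space. *)

Definition dotv d (u v : 'cV[R]_d) : R := (u^T *m v) 0 0.

Lemma dotvE d (u v : 'cV[R]_d) : dotv u v = \sum_i u i 0 * v i 0.
Proof. by rewrite /dotv mxE; apply: eq_bigr => i _; rewrite mxE. Qed.

Lemma dotvC d (u v : 'cV[R]_d) : dotv u v = dotv v u.
Proof. by rewrite !dotvE; apply: eq_bigr => i _; rewrite mulrC. Qed.

Lemma dotvDl d (u v w : 'cV[R]_d) : dotv (u + v) w = dotv u w + dotv v w.
Proof. by rewrite /dotv linearD /= mulmxDl mxE. Qed.

Lemma dotvNl d (u w : 'cV[R]_d) : dotv (- u) w = - dotv u w.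
Proof. by rewrite /dotv linearN /= mulNmx mxE. Qed.

Lemma dotvZl d (a : R) (u w : 'cV[R]_d) : dotv (a *: u) w = a * dotv u w.
Proof. by rewrite /dotv linearZ /= -scalemxAl mxE. Qed.

Lemma dotvDr d (u v w : 'cV[R]_d) : dotv w (u + v) = dotv w u + dotv w v.
Proof. by rewrite dotvC dotvDl !(dotvC w). Qed.

Lemma dotvNr d (u w : 'cV[R]_d) : dotv w (- u) = - dotv w u.
Proof. by rewrite dotvC dotvNl (dotvC w). Qed.

Lemma dotvZr d (a : R) (u w : 'cV[R]_d) : dotv w (a *: u) = a * dotv w u.
Proof. by rewrite dotvC dotvZl (dotvC w). Qed.

Lemma dotv0l d (w : 'cV[R]_d) : dotv 0 w = 0.
Proof. by rewrite /dotv trmx0 mul0mx mxE. Qed.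

Lemma dotv0r d (w : 'cV[R]_d) : dotv w 0 = 0.
Proof. by rewrite dotvC dotv0l. Qed.

Lemma dotv_mull d m (M : 'M[R]_(m, d)) (u : 'cV[R]_d) (v : 'cV[R]_m) :
  dotv (M *m u) v = dotv u (M^T *m v).
Proof. by rewrite /dotv trmx_mul mulmxA. Qed.

Lemma dotvv_ge0 d (u : 'cV[R]_d) : 0 <= dotv u u.
Proof. by rewrite dotvE sumr_ge0// => i _; rewrite -expr2 sqr_ge0. Qed.

Lemma dotvv_eq0 d (u : 'cV[R]_d) : (dotv u u == 0) = (u == 0).
Proof.
apply/eqP/eqP => [|->]; last by rewrite dotv0l.
rewrite dotvE => /eqP; rewrite psumr_eq0 => [|i _]; last first.
  by rewrite -expr2 sqr_ge0.
move=> /allP u0; apply/matrixP => i j; rewrite ord1 mxE.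
by have /= := u0 i (mem_index_enum i); rewrite -expr2 sqrf_eq0 => /eqP.
Qed.

Lemma outer_mulmx d (u v w : 'cV[R]_d) : u *m v^T *m w = dotv v w *: u.
Proof.
rewrite -mulmxA (_ : v^T *m w = (dotv v w)%:M) ?mul_mx_scalar//.
by apply/matrixP => i j; rewrite !ord1 [RHS]mxE mulr1n.
Qed.

Lemma mxtrace_outer d (u v : 'cV[R]_d) : \tr (u *m v^T) = dotv v u.
Proof. by rewrite mxtrace_mulC [LHS]big_ord1. Qed.

Lemma mxtrace_mul_tr_ge0 m d (M : 'M[R]_(m, d)) : 0 <= \tr (M *m M^T).
Proof.
apply: sumr_ge0 => i _; rewrite mxE; apply: sumr_ge0 => j _.
by rewrite mxE -expr2 sqr_ge0.
Qed.

End dot_product.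

Section pseudoinverse.
Context {R : realType}.

(* [L = X^+ + (L - L X X^+)] is an orthogonal decomposition of any left inverse
   [L] of [X], and [Tr (X X^T)^+] is the squared Frobenius norm of [X^+]. *)
Lemma mxtrace_MP_pinv_le d n (X : 'M[R]_(d, n)) (L : 'M[R]_(n, d)) B :
  is_MP_pinv (X *m X^T) B -> L *m X = 1%:M -> \tr B <= \tr (L *m L^T).
Proof.
set W := X *m X^T => -[WBW BWB WBT BWT] LX.
have WT : W^T = W by rewrite /W trmx_mul trmxK.
(* [E] is the orthogonal projector onto the range of [X]. From [L X = 1] one gets [L E = X^T B],
   which is [X^+]. *)
set E := W *m B.
have EE : E *m E = E by rewrite /E mulmxA WBW.
have ET : E^T = E by [].
have -> : \tr B = \tr (L *m E *m L^T).
  have BE : B = B *m B^T *m W by rewrite -{1}BWB -mulmxA -WBT trmx_mul WT mulmxA.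
  have -> : L *m E *m L^T = L *m E *m (L *m E)^T.
    by rewrite trmx_mul ET [in RHS]mulmxA -[L *m E *m E]mulmxA EE.
  have -> : L *m E = X^T *m B by rewrite /E /W !mulmxA LX mul1mx.
  rewrite [X in \tr X = _]BE /W mulmxA mxtrace_mulC trmx_mul trmxK !mulmxA.
  by [].
rewrite -subr_ge0 -raddfB /=.
have -> : L *m L^T - L *m E *m L^T = L *m (1%:M - E) *m (L *m (1%:M - E))^T.
  have -> : (L *m (1%:M - E))^T = (1%:M - E) *m L^T.
    by rewrite trmx_mul; congr (_ *m _); rewrite linearB /= ET trmx1.
  have EE1 : (1%:M - E) *m (1%:M - E) = 1%:M - E.
    by rewrite mulmxBl mul1mx mulmxBr mulmx1 EE subrr subr0.
  by rewrite [RHS]mulmxA -(mulmxA L (1%:M - E)) EE1 (mulmxBr L) mulmx1 mulmxBl.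
exact: mxtrace_mul_tr_ge0.
Qed.

Lemma mxtrace_mp_pinv_ge0 d n (X : 'M[R]_(d, n)) : 0 <= \tr (mp_pinv (X *m X^T)).
Proof.
(* If no pseudoinverse exists, [xget] yields 0. Otherwise [B = B B^T W] makes the trace the squared
   Frobenius norm of [X^T B]. *)
rewrite /mp_pinv; case: xgetP => [B _ [_ BWB WBT _]|_]; last by rewrite mxtrace0.
set W := X *m X^T in BWB WBT.
have WT : W^T = W by rewrite /W trmx_mul trmxK.
have BE : B = B *m B^T *m W by rewrite -{1}BWB -mulmxA -WBT trmx_mul WT mulmxA.
rewrite BE /W mulmxA mxtrace_mulC !mulmxA -mulmxA -[in X in _ *m X](trmxK X).
by rewrite -trmx_mul mxtrace_mul_tr_ge0.
Qed.

Lemma mxtrace_mp_pinv_le d n (X : 'M[R]_(d, n)) (L : 'M[R]_(n, d)) :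
  L *m X = 1%:M -> \tr (mp_pinv (X *m X^T)) <= \tr (L *m L^T).
Proof.
rewrite /mp_pinv; case: xgetP => [B _ BP /(mxtrace_MP_pinv_le BP)//|_ _].
by rewrite mxtrace0 mxtrace_mul_tr_ge0.
Qed.

End pseudoinverse.

(** * Factorisation of positive semidefinite matrices *)

Section cholesky.
Context {R : realType}.

Let psd d (S : 'M[R]_d) := S^T = S /\ forall x : 'cV[R]_d, 0 <= dotv x (S *m x).

Let dotv_delta d (S : 'M[R]_d) i j :
  dotv (delta_mx i 0 : 'cV[R]_d) (S *m delta_mx j 0) = S i j.
Proof. by rewrite -colE /dotv trmx_delta -rowE !mxE. Qed.

Let psd_diag0 d (S : 'M[R]_d) i j : psd S -> S i i = 0 -> S i j = 0.
Proof.
move=> [ST S0] Sii; apply/eqP/contraT => Sij.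
pose e k : 'cV[R]_d := delta_mx k 0.
(* As [S i i = 0], the form at [c e_i + e_j] is [2 c S i j + S j j], affine in [c]; this [c] makes
   it -1. *)
pose c := - (S j j + 1) / (2 * S i j).
have Sji : S j i = S i j by rewrite -[in LHS]ST mxE.
have := S0 (c *: e i + e j).
rewrite mulmxDr -scalemxAr dotvDl !dotvDr !dotvZl !dotvZr !dotv_delta Sii Sji.
have -> : c * (c * 0) + c * S i j + (c * S i j + S j j) = -1.
  by rewrite /c; field.
by rewrite ler0N1.
Qed.

(* One step of Cholesky elimination: the Schur complement of a diagonal entry. *)
Let psd_peel d (S : 'M[R]_d) i : psd S -> exists u : 'cV[R]_d,
  let S' := S - u *m u^T in
  [/\ psd S', forall j, S' i j = 0 &
      forall k, (forall j, S k j = 0) -> forall j, S' k j = 0].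
Proof.
move=> pS; have [ST S0] := pS.
have Sii0 : 0 <= S i i by have := S0 (delta_mx i 0); rewrite dotv_delta.
have [Sii|Sii] := eqVneq (S i i) 0.
  exists 0; rewrite /= mul0mx subr0; split => // j; exact: psd_diag0.
have sii : 0 < S i i by rewrite lt_def Sii.
pose r := Num.sqrt (S i i).
have rr : r * r = S i i by rewrite -expr2 sqr_sqrtr.
have r0 : r != 0 by rewrite gt_eqF// sqrtr_gt0.
exists (r^-1 *: col i S) => /=.
have E k j : (S - (r^-1 *: col i S) *m (r^-1 *: col i S)^T) k j =
    S k j - S k i * S j i / S i i.
  rewrite !mxE big_ord1 !mxE -rr; field; exact: r0.
have Sji k : S i k = S k i by rewrite -[in LHS]ST mxE.
split.
- split; first by rewrite linearB /= trmx_mul trmxK ST.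
  move=> x; rewrite mulmxBl outer_mulmx dotvDr dotvNr !dotvZr dotvZl.
  rewrite [dotv x (col i S)]dotvC.
  have -> : dotv (col i S) x = dotv (delta_mx i 0) (S *m x).
    by rewrite colE dotv_mull ST.
  set b := dotv (delta_mx i 0) _.
  (* The form of the Schur complement at [x] is the minimum over [c] of the form of [S] at
     [x - c e_i], attained at this [c]. *)
  pose c := b / S i i.
  have := S0 (x - c *: delta_mx i 0).
  rewrite mulmxBr -scalemxAr !(dotvDl, dotvDr, dotvNl, dotvNr, dotvZl, dotvZr).
  rewrite dotv_delta -/b.
  have -> : dotv x (S *m delta_mx i 0) = b by rewrite dotvC dotv_mull ST.
  congr (_ <= _); rewrite /c -rr; field; exact: r0.
- by move=> j; rewrite E Sji mulrAC divff// mul1r subrr.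
- by move=> k Sk j; rewrite E !Sk !mul0r subrr.
Qed.

(** Rows that vanish stay zero under later peeling, so peeling every index leaves the zero matrix.
    [S] is then the sum of [u u^T] over [d] peeled vectors, the columns of [A]. *)
Lemma cholesky d (S : 'M[R]_d) : S^T = S ->
  (forall x : 'cV[R]_d, 0 <= dotv x (S *m x)) -> exists A : 'M[R]_d, S = A *m A^T.
Proof.
move=> ST S0.
have peel (s : seq 'I_d) : exists us : seq 'cV[R]_d, size us = size s /\
    let S' := S - \sum_(u <- us) u *m u^T in
    psd S' /\ forall i, i \in s -> forall j, S' i j = 0.
  elim: s => [|i s [us /= [sus [pS us0]]]].
    by exists [::]; rewrite /= big_nil subr0.
  have [u /= [pu u0 su]] := psd_peel i pS.
  exists (u :: us) => /=; rewrite sus big_cons [_ *m _ + _]addrC opprD addrA.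
  split => //; split => // k.
  by rewrite inE => /predU1P[->//|/us0/su].
have [us [sus [_ us0]]] := peel (enum 'I_d).
exists (\matrix_(i, j) us`_j i 0); apply/matrixP => i k.
have := us0 i (mem_enum _ _) k; rewrite mxE => /eqP.
rewrite [X in _ + X]mxE subr_eq0 => /eqP ->.
rewrite summxE (big_nth 0) big_mkord sus size_enum_ord mxE.
by apply: eq_bigr => j _; rewrite !mxE big_ord1 !mxE.
Qed.

End cholesky.

(** * Orthogonal projections and their deflation by vectors *)

Section deflation.
Context {R : realType}.

Definition is_proj d (P : 'M[R]_d) := P^T = P /\ P *m P = P.

(* If [P] projects onto a subspace [V], then [defl P z] projects onto the
   orthogonal complement in [V] of the projection of [z]; since [0^-1 = 0], it is
   [P] itself when [P z = 0]. *)
Definition defl d (P : 'M[R]_d) (z : 'cV[R]_d) : 'M[R]_d :=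
  P - (dotv (P *m z) (P *m z))^-1 *: ((P *m z) *m (P *m z)^T).

Definition defls d (s : seq 'cV[R]_d) : 'M[R]_d :=
  foldr (fun z P => defl P z) 1%:M s.

Lemma is_proj1 d : is_proj (1%:M : 'M[R]_d).
Proof. by split; rewrite ?trmx1 ?mulmx1. Qed.

Lemma proj_dotv d (P : 'M[R]_d) (u v : 'cV[R]_d) : is_proj P ->
  dotv (P *m u) (P *m v) = dotv (P *m u) v.
Proof.
by move=> [PT PP]; rewrite dotv_mull PT mulmxA PP dotvC dotv_mull PT dotvC.
Qed.

Lemma defl_mul d (P : 'M[R]_d) (z v : 'cV[R]_d) : is_proj P -> defl P z *m v =
  P *m v - ((dotv (P *m z) (P *m z))^-1 * dotv (P *m z) v) *: (P *m z).
Proof. by move=> pP; rewrite /defl mulmxBl -scalemxAl outer_mulmx scalerA. Qed.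

Lemma defl_mul_self d (P : 'M[R]_d) (z : 'cV[R]_d) : is_proj P -> defl P z *m z = 0.
Proof.
move=> pP; rewrite defl_mul// -(proj_dotv z z pP).
have [y0|y0] := eqVneq (P *m z) 0; first by rewrite y0 scaler0 subrr.
by rewrite mulVf ?dotvv_eq0// scale1r subrr.
Qed.

Lemma defl_mul0 d (P : 'M[R]_d) (z v : 'cV[R]_d) : is_proj P -> P *m v = 0 ->
  defl P z *m v = 0.
Proof.
by move=> pP Pv; rewrite defl_mul// -(proj_dotv z v pP) Pv dotv0r mulr0 scale0r subrr.
Qed.

Lemma is_proj_defl d (P : 'M[R]_d) (z : 'cV[R]_d) : is_proj P -> is_proj (defl P z).
Proof.
move=> pP; have [PT PP] := pP; split.
  by rewrite /defl linearB linearZ /= trmx_mul trmxK PT.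
rewrite {2}/defl mulmxBr -scalemxAr mulmxA.
have -> : defl P z *m (P *m z) = 0.
  rewrite defl_mul// mulmxA PP; have [y0|y0] := eqVneq (P *m z) 0.
    by rewrite y0 scaler0 subrr.
  by rewrite mulVf ?dotvv_eq0// scale1r subrr.
rewrite mul0mx scaler0 subr0 /defl mulmxBl PP -scalemxAl -mulmxA.
by rewrite trmx_mul PT -!mulmxA PP.
Qed.

Lemma is_proj_defls d (s : seq 'cV[R]_d) : is_proj (defls s).
Proof. by elim: s => [|z s IH] /=; [exact: is_proj1|exact: is_proj_defl]. Qed.

Lemma defls_mul0 d (s : seq 'cV[R]_d) (z : 'cV[R]_d) : z \in s -> defls s *m z = 0.
Proof.
elim: s => //= w s IH; rewrite inE => /predU1P[->|/IH].
  by rewrite defl_mul_self//; exact: is_proj_defls.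
by apply: defl_mul0; exact: is_proj_defls.
Qed.

Lemma mxtrace_defl d (P : 'M[R]_d) (z : 'cV[R]_d) :
  \tr (defl P z) = \tr P - (P *m z != 0)%:R.
Proof.
rewrite /defl raddfB /= mxtraceZ mxtrace_outer.
have [->|y0] := eqVneq (P *m z) 0; first by rewrite dotv0l mulr0.
by rewrite mulVf ?dotvv_eq0.
Qed.

(** A deflation lowers the trace by one, or leaves it unchanged if the vector is already
    annihilated; linear dependence can only increase the trace. *)
Lemma mxtrace_defls_ge d (s : seq 'cV[R]_d) :
  d%:R - (size s)%:R <= \tr (defls s) :> R.
Proof.
elim: s => [|z s IH] /=; first by rewrite mxtrace1 subr0.
rewrite mxtrace_defl -natr1 opprD addrA lerB//.
by case: (_ != _); rewrite ?ler01.
Qed.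

Lemma dotv_defl d (P : 'M[R]_d) (z v : 'cV[R]_d) : is_proj P ->
  dotv (defl P z *m v) (defl P z *m v) =
  dotv (P *m v) (P *m v) - dotv (P *m v) z ^+ 2 / dotv (P *m z) (P *m z).
Proof.
move=> pP; have pD := is_proj_defl z pP.
rewrite proj_dotv// defl_mul// dotvDl dotvNl dotvZl proj_dotv//.
have -> : dotv (P *m z) v = dotv (P *m v) z.
  by rewrite -proj_dotv// dotvC proj_dotv.
by rewrite (proj_dotv v v pP); ring.
Qed.

End deflation.

Section orthonormal.
Context {R : realType}.

Fixpoint orthonormal d (us : seq 'cV[R]_d) : Prop :=
  if us is u :: us' then
    [/\ dotv u u = 1, (forall w, w \in us' -> dotv u w = 0) & orthonormal us']
  else True.

Lemma orthonormal_unit d (us : seq 'cV[R]_d) (u : 'cV[R]_d) :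
  orthonormal us -> u \in us -> dotv u u = 1.
Proof.
by elim: us => //= w us IH [ww _ /IH ous]; rewrite inE => /predU1P[->|].
Qed.

Lemma orthonormal_uniq d (us : seq 'cV[R]_d) : orthonormal us -> uniq us.
Proof.
elim: us => //= u us IH [uu u0 /IH ->]; rewrite andbT.
by apply/negP => /u0; rewrite uu => /eqP; rewrite oner_eq0.
Qed.

Let proj_spec d (Q : 'M[R]_d) (us : seq 'cV[R]_d) :=
  [/\ orthonormal us, Q = \sum_(u <- us) u *m u^T & \tr Q = (size us)%:R].

(** The difference is [defl Q u]. It kills [u] and fixes every vector of [us], which forces these to
    be orthogonal to [u]. *)
Let peel_proj d (Q : 'M[R]_d) (u : 'cV[R]_d) : is_proj Q -> Q *m u = u -> dotv u u = 1 ->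
  is_proj (Q - u *m u^T) /\
  (forall us, proj_spec (Q - u *m u^T) us -> proj_spec Q (u :: us)).
Proof.
move=> pQ Qu uu; have [QT QQ] := pQ.
have -> : Q - u *m u^T = defl Q u by rewrite /defl Qu uu invr1 scale1r.
have pD := is_proj_defl u pQ.
split => // us [ous Dus tD]; split.
- split => // w wus; rewrite dotvC -[w](_ : defl Q u *m w = w).
    by rewrite -proj_dotv// defl_mul_self// dotv0r.
  rewrite Dus mulmx_suml (bigD1_seq w)//=; last exact: orthonormal_uniq.
  rewrite outer_mulmx (orthonormal_unit ous wus) scale1r.
  rewrite big_seq_cond big1 ?addr0// => v /andP[vus vw].
  rewrite outer_mulmx.
  suff -> : dotv v w = 0 by rewrite scale0r.
  elim: us ous vus wus vw {Dus tD} => //= x us IH [_ x0 ous].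
  rewrite !inE => /predU1P[->|vus] /predU1P[->|wus]; rewrite ?eqxx// => vw.
  + exact: x0.
  + by rewrite dotvC x0.
  + exact: IH.
- by rewrite big_cons -Dus /defl Qu uu invr1 scale1r addrCA subrr addr0.
- move: tD; rewrite mxtrace_defl Qu.
  have -> : u != 0 by rewrite -dotvv_eq0 uu oner_eq0.
  by move=> /eqP; rewrite subr_eq => /eqP -> /=; rewrite natr1.
Qed.

Let proj_range_unit d (Q : 'M[R]_d) (v : 'cV[R]_d) : is_proj Q -> Q *m v != 0 ->
  exists u, [/\ Q *m u = u, dotv u u = 1 &
    Q *m v = Num.sqrt (dotv (Q *m v) (Q *m v)) *: u].
Proof.
move=> [_ QQ] Qv0; set r := Num.sqrt _.
have r0 : r != 0 by rewrite gt_eqF// sqrtr_gt0 lt_def dotvv_eq0 Qv0 dotvv_ge0.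
exists (r^-1 *: (Q *m v)); split.
- by rewrite -scalemxAr mulmxA QQ.
- rewrite dotvZl dotvZr -[dotv _ _]sqr_sqrtr ?dotvv_ge0// -/r.
  by field.
- by rewrite scalerA divff// scale1r.
Qed.

Lemma proj_orthonormal d (Q : 'M[R]_d) : is_proj Q ->
  exists us, [/\ orthonormal us, Q = \sum_(u <- us) u *m u^T & \tr Q = (size us)%:R].
Proof.
(* Induction on an integer bound for the trace: peeling a unit vector lowers the trace by one, and
   it is nonnegative for a projection. *)
have [m] : exists m : nat, \tr Q < m%:R.
  exists (Num.truncn (\tr Q)).+1.
  by rewrite truncnS_gt.
elim: m Q => [|m IH] Q Qm pQ.
  have : 0 <= \tr Q.
    by have [QT QQ] := pQ; rewrite -QQ -[X in _ *m X]QT mxtrace_mul_tr_ge0.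
  by rewrite leNgt Qm.
have [->|Q0] := eqVneq Q 0.
  by exists [::]; split => //; rewrite ?big_nil ?mxtrace0.
have [v Qv0] : exists v : 'cV[R]_d, Q *m v != 0.
  apply/not_existsP => h; move/eqP : Q0; apply.
  apply/matrixP => i j; have /negP := h (delta_mx j 0); rewrite negbK => /eqP.
  by rewrite -colE => /matrixP/(_ i 0); rewrite !mxE.
have [u [Qu uu _]] := proj_range_unit pQ Qv0.
have [pD Dus] := peel_proj pQ Qu uu.
have [|us usD] := IH _ _ pD; last by exists (u :: us); exact: Dus.
have := mxtrace_defl Q u; rewrite /defl Qu uu invr1 scale1r => ->.
have -> : u != 0 by rewrite -dotvv_eq0 uu oner_eq0.
by rewrite ltrBlDr natr1.
Qed.

(** The basis begins with the direction of [Q v], so that products with [Q v] become multiples of a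
    single coordinate. *)
Lemma proj_orthonormal_cons d (Q : 'M[R]_d) (v : 'cV[R]_d) : is_proj Q -> Q *m v != 0 ->
  exists u us, [/\ orthonormal (u :: us), Q = \sum_(w <- u :: us) w *m w^T,
    \tr Q = (size (u :: us))%:R &
    Q *m v = Num.sqrt (dotv (Q *m v) (Q *m v)) *: u].
Proof.
move=> pQ /(proj_range_unit pQ)[u [Qu uu Qv]].
have [pD Dus] := peel_proj pQ Qu uu.
have [us /Dus[ous QE tQ]] := proj_orthonormal pD.
by exists u, us.
Qed.

End orthonormal.

(** * One-dimensional integrals *)

Section gaussian_1d.
Context {R : realType}.
Notation mu := (@lebesgue_measure R).
Notation phi := (normal_pdf (0 : R) 1).

Lemma integral_normal_prob (m s : R) (f : R -> \bar R) : measurable_fun [set: R] f ->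
  (\int[normal_prob m s]_x `|f x| < +oo)%E ->
  (\int[normal_prob m s]_x f x = \int[mu]_x (f x * (normal_pdf m s x)%:E))%E.
Proof.
move=> mf finf.
have dom : normal_prob m s `<< mu := normal_prob_dominates m s.
rewrite -(Radon_Nikodym_change_of_variables dom)//=; last exact/integrableP.
have mpdf : measurable_fun [set: R] (fun x => (normal_pdf m s x)%:E).
  by apply/measurable_EFinP; exact: measurable_normal_pdf.
apply: ae_eq_integral => //.
- exact: emeasurable_funM.
- exact: emeasurable_funM.
(* The density and the Radon-Nikodym derivative have the same integral over every measurable set,
   hence agree almost everywhere. *)
- apply: ae_eqe_mul2l => /=.
  rewrite Radon_NikodymE//=; case: cid => /= h [_ ih hE].
  apply: integral_ae_eq => //= E _ mE.
  by rewrite -hE.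
Qed.

Lemma normal_pdf01E (t : R) : phi t = normal_peak 1 * expR (- t ^+ 2 / 2).
Proof.
by rewrite normal_pdfE ?oner_neq0//= /normal_fun subr0 expr1n.
Qed.

Lemma is_derive_normal_pdf01 (t : R) : is_derive t 1 phi (- t * phi t).
Proof.
rewrite (_ : phi = (fun x => normal_peak 1 * expR (- x ^+ 2 / 2))); last first.
  by apply/funext => x; exact: normal_pdf01E.
apply: is_derive_eq.
by rewrite /GRing.scale /=; field.
Qed.

Lemma normal_pdf01_ge0 (t : R) : 0 <= phi t.
Proof. exact: normal_pdf_ge0. Qed.

Lemma integrable_id_normal_pdf01 :
  mu.-integrable setT (EFin \o (fun t : R => `|t| * phi t)).
Proof.
have s2 : Num.sqrt 2 != 0 :> R by rewrite gt_eqF// sqrtr_gt0.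
(* Domination by the density of variance 2, renormalised: [|t| <= 1 + t^2/4 <= exp (t^2/4)]. *)
pose C := normal_peak (1 : R) / normal_peak (Num.sqrt 2).
have C0 : 0 <= C by rewrite divr_ge0 ?normal_peak_ge0.
have mphi : measurable_fun [set: R] phi by exact: measurable_normal_pdf.
apply: (@le_integrable _ _ _ mu setT measurableT _
  (EFin \o (fun t => C * normal_pdf 0 (Num.sqrt 2) t))).
- by apply/measurable_EFinP; apply: measurable_funM => //; exact: measurableT_comp.
- move=> t _ /=; rewrite lee_fin.
  rewrite (ger0_norm (mulr_ge0 (normr_ge0 t) (normal_pdf01_ge0 t))).
  rewrite (ger0_norm (mulr_ge0 C0 (normal_pdf_ge0 0 _ t))).
  rewrite normal_pdf01E normal_pdfE// /normal_fun subr0 sqr_sqrtr//.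
  rewrite [leRHS]mulrA /C divfK ?gt_eqF ?normal_peak_gt0// mulrCA.
  rewrite ler_wpM2l ?normal_peak_ge0//.
  rewrite -(ler_pdivlMr _ _ (expR_gt0 _)) -expRN -expRD.
  apply: le_trans (expR_ge1Dx _).
  have <- : `|t| ^+ 2 = t ^+ 2 by rewrite real_normK// num_real.
  by have := sqr_ge0 (`|t| / 2 - 1); lra.
- rewrite (_ : _ \o _ = fun t => (C%:E * (normal_pdf 0 (Num.sqrt 2) t)%:E)%E)//.
  by apply: integrableZl => //; exact: integrable_normal_pdf.
Qed.

Lemma bounded_normal_integrable (f : R -> R) (M : R) : measurable_fun [set: R] f ->
  (forall t, `|f t| <= M) -> mu.-integrable setT (EFin \o (fun t => f t * phi t)).
Proof.
move=> mf fM.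
apply: (@le_integrable _ _ _ mu setT measurableT _ (EFin \o (fun t => M * phi t))).
- apply/measurable_EFinP/measurable_funM => //; exact: measurable_normal_pdf.
- move=> t _ /=; rewrite lee_fin normrM (ger0_norm (normal_pdf01_ge0 t)).
  have M0 : 0 <= M by apply: le_trans (fM t).
  by rewrite (ger0_norm (mulr_ge0 M0 (normal_pdf01_ge0 t))) ler_wpM2r ?normal_pdf01_ge0.
- rewrite (_ : _ \o _ = fun t => (M%:E * (phi t)%:E)%E)//.
  apply: integrableZl => //; exact: integrable_normal_pdf.
Qed.

Lemma continuous_measurable_sin : measurable_fun [set: R] (@sin R).
Proof. by apply: continuous_measurable_fun; exact: continuous_sin. Qed.
Lemma continuous_measurable_cos : measurable_fun [set: R] (@cos R).
Proof. by apply: continuous_measurable_fun; exact: continuous_cos. Qed.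

(** Characteristic function of [N(0,1)]. It is found from the equation [F' c = - c F c]:
    differentiation under the integral, dominated by [|t| phi t], gives a sine integral, and
    integration by parts with [phi' t = - t phi t] turns that back into [F]. *)
Let F (c : R) := (\int[mu]_t (cos (c * t) * phi t))%R.

Let integrable_sin_id (c : R) :
  mu.-integrable setT (EFin \o (fun t => sin (c * t) * (t * phi t))).
Proof.
have mphi : measurable_fun [set: R] phi by exact: measurable_normal_pdf.
apply: (le_integrable measurableT _ _ integrable_id_normal_pdf01) => /=.
  apply/measurable_EFinP; apply: measurable_funM; last exact: measurable_funM.
  by apply: measurableT_comp; [exact: continuous_measurable_sin|exact: measurable_funM].
move=> t _; rewrite lee_fin [leRHS]ger0_norm ?mulr_ge0 ?normal_pdf01_ge0//.
by rewrite !normrM (ger0_norm (normal_pdf01_ge0 t)) ler_piMl ?mulr_ge0 ?normal_pdf01_ge0 ?sin_max.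
Qed.

Let dF (c : R) : derivable F c 1 /\
  derive1 F c = - (\int[mu]_t (sin (c * t) * (t * phi t)))%R.
Proof.
have dcos (t x : R) : is_derive x 1 (fun x => cos (x * t) * phi t) (- sin (x * t) * (t * phi t)).
  apply: is_derive_eq; rewrite /GRing.scale /=; ring.
have Ic : `]c - 1, c + 1[%classic c.
  by rewrite /= in_itv /=; apply/andP; split; lra.
have mcos x : measurable_fun [set: R] (fun t : R => cos (x * t)).
  apply: measurableT_comp; first exact: continuous_measurable_cos.
  exact: measurable_funM.
have i1 x : `]c - 1, c + 1[%classic x ->
   mu.-integrable setT (EFin \o (fun t => cos (x * t) * phi t)).
  move=> _; apply: (@bounded_normal_integrable _ 1) => //.
  by move=> t; exact: cos_max.
have i2 (x t : R) : `]c - 1, c + 1[%classic x -> setT t ->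
    derivable ((fun x t => cos (x * t) * phi t) ^~ t) x 1.
  by move=> _ _; apply: ex_derive.
have pE (x t : R) : partial1of2 (fun x t => cos (x * t) * phi t) x t =
    - sin (x * t) * (t * phi t).
  by rewrite partial1of2E; apply: derive_val.
have G0 (t : R) : 0 <= `|t| * phi t by rewrite mulr_ge0// normal_pdf01_ge0.
have Gub (x t : R) : `]c - 1, c + 1[%classic x -> setT t ->
    `|partial1of2 (fun x t => cos (x * t) * phi t) x t| <= `|t| * phi t.
  move=> _ _; rewrite pE !normrM normrN (ger0_norm (normal_pdf01_ge0 t)).
  by rewrite ler_piMl ?sin_max.
split.
  exact: (derivable_under_integral measurableT Ic i1 i2 G0 integrable_id_normal_pdf01 Gub).
rewrite (differentiation_under_integral measurableT Ic i1 i2 G0 integrable_id_normal_pdf01 Gub).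
under eq_Rintegral do rewrite pE mulNr -mulN1r.
by rewrite RintegralZl// ?mulN1r//; exact: integrable_sin_id.
Qed.

(** The fundamental theorem of calculus on growing symmetric intervals, then dominated convergence
    with [|h|] as bound. *)
Let integral_derive_vanish (H h : R -> R) : (forall x : R, is_derive x 1 H (h x)) ->
  continuous h -> mu.-integrable setT (EFin \o h) ->
  H n.+1%:R @[n --> \oo] --> 0 -> H (- n.+1%:R) @[n --> \oo] --> 0 ->
  (\int[mu]_x h x)%R = 0.
Proof.
move=> dH ch ih H1 H2.
have mh : measurable_fun [set: R] (EFin \o h).
  by apply/measurable_EFinP; exact: continuous_measurable_fun.
(* [n.+1] rather than [n] keeps the interval nondegenerate. *)
pose D (n : nat) : set R := `[- n.+1%:R, n.+1%:R]%classic.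
pose f_ (n : nat) := (EFin \o h) \_ (D n).
have mf_ n : measurable_fun [set: R] (f_ n).
  apply/(measurable_restrictT _ _).1; first exact: measurable_itv.
  exact: measurable_funTS.
have f_h x : f_ ^~ x @ \oo --> (EFin \o h) x.
  apply: cvg_near_cst; exists (Num.truncn `|x|) => // n /= xn.
  rewrite /f_ patchE ifT// inE /D /= in_itv /= -ler_norml ltW//.
  by apply: lt_le_trans (truncnS_gt _) _; rewrite ler_nat ltnS.
have dom x n : (`|f_ n x| <= (abse \o (EFin \o h)) x)%E.
  by rewrite /f_ patchE; case: ifPn => // _; rewrite abse0 abse_ge0.
have ae1 : {ae mu, forall x, setT x -> f_ ^~ x @ \oo --> (EFin \o h) x}.
  by apply: aeW => x _; exact: f_h.
have ae2 : {ae mu, forall x n, setT x -> (`|f_ n x| <= (abse \o (EFin \o h)) x)%E}.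
  by apply: aeW => x n _; exact: dom.
have [_ _ cv] := @dominated_convergence _ _ _ mu setT measurableT f_ (EFin \o h)
   (abse \o (EFin \o h)) mf_ mh ae1 (integrable_abse ih) ae2.
have fE n : (\int[mu]_x f_ n x = (H n.+1%:R - H (- n.+1%:R))%:E)%E.
  rewrite -integral_mkcond (@continuous_FTC2 _ h H) ?EFinB//.
  - by rewrite -subr_gt0 opprK -natrD.
  - exact: continuous_subspaceT.
  - have cH : continuous H.
      by move=> x; apply: differentiable_continuous; apply/derivable1_diffP; have [] := dH x.
    split; first by move=> x _; have [] := dH x.
    + exact/cvg_at_right_filter/cH.
    + exact/cvg_at_left_filter/cH.
  - by move=> x _; rewrite derive1E; have [] := dH x.
have cv0 : (\int[mu]_x f_ n x)%E @[n --> \oo] --> 0%E.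
  under eq_fun do rewrite fE.
  apply: cvg_EFin; first exact: nearW.
  by rewrite -[X in _ --> X]subr0; exact: cvgB.
rewrite /Rintegral; have -> // : (\int[mu]_x (h x)%:E = 0)%E.
exact: (cvg_unique _ cv cv0).
Qed.

Let cvg_normal_pdf01 : phi n.+1%:R @[n --> \oo] --> 0.
Proof.
(* [(x - 1)^2 >= 0] gives [- x^2/2 <= 1/2 - x]. *)
have cv : normal_peak (1 : R) * expR (2^-1) * expR (- n.+1%:R) @[n --> \oo] --> (0 : R).
  rewrite -[X in _ --> X](mulr0 (normal_peak 1 * expR (2^-1))).
  apply: cvgM; first exact: cvg_cst.
  by have := @cvgn_expR R; rewrite -(cvg_shiftS (fun n => expR (- n%:R))).
apply: squeeze_cvgr cv; last exact: cvg_cst.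
apply: nearW => n; rewrite normal_pdf01_ge0/= normal_pdf01E -mulrA.
rewrite ler_wpM2l ?normal_peak_ge0// -expRD ler_expR.
by have := sqr_ge0 (n.+1%:R - 1 : R); lra.
Qed.

Let integral_sin_id (c : R) :
  (\int[mu]_t (sin (c * t) * (t * phi t)))%R = c * F c.
Proof.
have mcos : measurable_fun [set: R] (fun t : R => cos (c * t)).
  by apply: measurableT_comp; [exact: continuous_measurable_cos|exact: measurable_funM].
have i1 := integrable_sin_id c.
have i2 : mu.-integrable setT (EFin \o (fun t => cos (c * t) * phi t)).
  by apply: (@bounded_normal_integrable _ 1) => // t; exact: cos_max.
have i3 : mu.-integrable setT (EFin \o (fun t => c * (cos (c * t) * phi t))).
  rewrite (_ : _ \o _ = fun t => (c%:E * (cos (c * t) * phi t)%:E)%E)//.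
  exact: integrableZl.
have dH (t : R) : is_derive t 1 (fun t => sin (c * t) * phi t)
    (c * (cos (c * t) * phi t) - sin (c * t) * (t * phi t)).
  have := is_derive_normal_pdf01 t => dphi.
  apply: is_derive_eq; rewrite /GRing.scale /=; ring.
have cphi : continuous phi by apply: continuous_normal_pdf; exact: oner_neq0.
have ccos : continuous (fun t : R => cos (c * t)).
  by move=> t; apply: continuous_comp; [exact: mulrl_continuous|exact: continuous_cos].
have csin : continuous (fun t : R => sin (c * t)).
  by move=> t; apply: continuous_comp; [exact: mulrl_continuous|exact: continuous_sin].
have H0 (u : R ^nat) : phi (u n) @[n --> \oo] --> 0 ->
    sin (c * u n) * phi (u n) @[n --> \oo] --> 0.
  move=> hu; apply/norm_cvg0P.
  apply: squeeze_cvgr hu; last exact: cvg_cst.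
  apply: nearW => n; rewrite normr_ge0/= normrM (ger0_norm (normal_pdf01_ge0 _)).
  by rewrite ler_piMl ?normal_pdf01_ge0 ?sin_max.
have := integral_derive_vanish dH _ _ (H0 _ cvg_normal_pdf01).
rewrite RintegralB// RintegralZl// -/(F c) => H.
apply/esym/eqP; rewrite -subr_eq0; apply/eqP; apply: H.
- move=> t; apply: cvgB; apply: cvgM.
  + exact: cvg_cst.
  + by apply: cvgM; [exact: ccos|exact: cphi].
  + exact: csin.
  + by apply: cvgM; [exact: cvg_id|exact: cphi].
- rewrite (_ : _ \o _ = fun t => ((c * (cos (c * t) * phi t))%:E - (sin (c * t) * (t * phi t))%:E)%E)//.
  exact: integrableB.
- apply: H0; rewrite (_ : (fun _ => _) = (fun n => phi n.+1%:R)) //.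
  by apply/funext => n; rewrite !normal_pdf01E sqrrN.
Qed.

Lemma integral_cos_normal_pdf01 (c : R) :
  (\int[mu]_t (cos (c * t) * phi t))%R = expR (- c ^+ 2 / 2).
Proof.
rewrite -/(F c).
have dG (x : R) : is_derive x 1 (fun x => F x * expR (x ^+ 2 / 2)) 0.
  have dFx : is_derive x 1 F (- (x * F x)).
    have [d1 d2] := dF x; apply: DeriveDef => //.
    by rewrite -derive1E d2 integral_sin_id.
  by apply: is_derive_eq; rewrite /GRing.scale /=; field.
have F0 : F 0 = 1.
  rewrite /F; under eq_Rintegral do rewrite mul0r cos0 mul1r.
  by rewrite /Rintegral integral_normal_pdf.
have := @is_derive_0_is_cst R _ c 0 dG.
rewrite F0 expr0n /= mul0r expR0 mulr1 => /(canRL (mulfK _)) ->.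
  by rewrite mul1r -expRN mulNr.
by rewrite gt_eqF ?expR_gt0.
Qed.

(* With variance [x^-2] the Gaussian density is [x] times the density of [N(0,1)]
   tilted by [exp (- (x^2 - 1) t^2 / 2)]. *)
Lemma integral_expR_normal_pdf01 (x : R) : 0 < x ->
  (\int[mu]_t (expR (- (x ^+ 2 - 1) / 2 * t ^+ 2) * phi t))%R = x^-1.
Proof.
move=> x0; have xV0 : x^-1 != 0 by rewrite gt_eqF// invr_gt0.
have pE : normal_peak (x^-1) = x * normal_peak 1.
  rewrite /normal_peak expr1n mul1r -mulrnAr sqrtrM ?sqr_ge0//.
  by rewrite sqrtr_sqr gtr0_norm ?invr_gt0// invfM invrK.
have fE t : expR (- (x ^+ 2 - 1) / 2 * t ^+ 2) * phi t = x^-1 * normal_pdf 0 x^-1 t.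
  rewrite normal_pdf01E normal_pdfE// pE /normal_fun subr0.
  rewrite mulrCA -!mulrA mulKf ?gt_eqF// -expRD; congr (_ * expR _).
  by rewrite exprVn; field; rewrite gt_eqF.
under eq_Rintegral do rewrite fE.
rewrite RintegralZl//; last exact: integrable_normal_pdf.
by rewrite /Rintegral integral_normal_pdf mulr1.
Qed.

End gaussian_1d.

(** * Laplace formulas for [1/q] and [1/q^2], and integrals of negative powers *)

Section tail_integrals.
Context {R : realType}.
Notation mu := (@lebesgue_measure R).

Let cvg_tail (q : R) : 0 < q ->
  expR (- ((x ^+ 2 - 1) / 2 * q)) @[x --> +oo] --> (0 : R).
Proof.
move=> q0.
have xq : (x : R) * q @[x --> +oo] --> +oo by apply: gt0_cvgMly => //; exact: cvg_id.
have cv : expR q * expR (- (x * q)) @[x --> +oo] --> (0 : R).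
  rewrite -[X in _ --> X](mulr0 (expR q)); apply: cvgM; first exact: cvg_cst.
  exact: (cvg_comp _ _ xq (@cvgr_expR R)).
apply: squeeze_cvgr cv; last exact: cvg_cst.
apply: nearW => x; rewrite expR_ge0/= -expRD ler_expR.
have : 0 <= (x - 1) ^+ 2 * q by rewrite mulr_ge0 ?sqr_ge0 ?ltW.
lra.
Qed.

(** This is the integral of [exp (- s q)] over [s > 0] after the substitution [s = (x^2 - 1) / 2],
    [ds = x dx], which turns the Gaussian factor [(1 + 2 s)^(-k/2)] into [x^-k]. *)
Lemma integral_laplace_inv (q : R) : 0 < q ->
  (\int[mu]_(x in `[1%R, +oo[) (x * expR (- ((x ^+ 2 - 1) / 2 * q)))%:E = q^-1%:E)%E.
Proof.
move=> q0; have qn0 : q != 0 by rewrite gt_eqF.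
pose F (x : R) := - (q^-1 * expR (- ((x ^+ 2 - 1) / 2 * q))).
have dF (x : R) : is_derive x 1 F (x * expR (- ((x ^+ 2 - 1) / 2 * q))).
  by apply: is_derive_eq; rewrite /GRing.scale /=; field.
have cF : continuous F.
  by move=> x; apply: differentiable_continuous; apply/derivable1_diffP; have [] := dF x.
rewrite (@ge0_continuous_FTC2y _ _ F 1 0).
- by rewrite /F expr1n subrr !mul0r oppr0 expR0 mulr1 EFinN sub0e oppeK.
- by move=> x x1; rewrite mulr_ge0 ?expR_ge0// (le_trans ler01).
- apply: continuous_subspaceT => x; apply: cvgM; first exact: cvg_id.
  apply: continuous_comp; last exact: continuous_expR.
  apply: (@cvgN _ R^o); apply: cvgM; last exact: cvg_cst.
  apply: cvgM; last exact: cvg_cst.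
  by apply: (@cvgB _ R^o); [exact: exprn_continuous|exact: cvg_cst].
- have e0 : - (q^-1 * 0) = 0 by rewrite mulr0 oppr0.
  rewrite -[X in _ --> X]e0.
  by apply: (@cvgN _ R^o); apply: cvgM; [exact: cvg_cst|exact: (cvg_tail q0)].
- by move=> x _; have [] := dF x.
- exact/cvg_at_right_filter/cF.
- by move=> x _; rewrite derive1E; have [] := dF x.
Qed.

(** The same substitution in the integral of [s exp (- s q)]. *)
Lemma integral_laplace_inv2 (q : R) : 0 < q ->
  (\int[mu]_(x in `[1%R, +oo[) (x * ((x ^+ 2 - 1) / 2) *
     expR (- ((x ^+ 2 - 1) / 2 * q)))%:E = (q ^- 2)%:E)%E.
Proof.
move=> q0; have qn0 : q != 0 by rewrite gt_eqF.
pose F (x : R) := - ((q^-1 * ((x ^+ 2 - 1) / 2) + q^-1 * q^-1) * expR (- ((x ^+ 2 - 1) / 2 * q))).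
have dF (x : R) : is_derive x 1 F (x * ((x ^+ 2 - 1) / 2) * expR (- ((x ^+ 2 - 1) / 2 * q))).
  by apply: is_derive_eq; rewrite /GRing.scale /=; field.
have cF : continuous F.
  by move=> x; apply: differentiable_continuous; apply/derivable1_diffP; have [] := dF x.
rewrite (@ge0_continuous_FTC2y _ _ F 1 0).
- have -> : F 1 = - q ^- 2.
    by rewrite /F expr1n subrr !mul0r oppr0 expR0 mulr0 add0r mulr1 expr2 invfM.
  by rewrite EFinN sub0e oppeK.
- move=> x x1; have x0 : 0 <= x by rewrite (le_trans ler01).
  rewrite mulr_ge0 ?expR_ge0// mulr_ge0//.
  by rewrite divr_ge0// subr_ge0 expr2 -[1]mulr1 ler_pM.
- apply: continuous_subspaceT => x.
  have c2 : (fun y : R => (y ^+ 2 - 1) / 2) y @[y --> x] --> (x ^+ 2 - 1) / 2.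
    apply: cvgM; last exact: cvg_cst.
    by apply: (@cvgB _ R^o); [exact: exprn_continuous|exact: cvg_cst].
  apply: cvgM; first by apply: cvgM => //; exact: cvg_id.
  apply: continuous_comp; last exact: continuous_expR.
  by apply: (@cvgN _ R^o); apply: cvgM => //; exact: cvg_cst.
- rewrite -[X in _ --> X]oppr0; apply: (@cvgN _ R^o).
  have cv : 2 * q ^- 2 * expR (- ((x ^+ 2 - 1) / 2 * (q / 2))) @[x --> +oo] --> (0 : R).
    rewrite -[X in _ --> X](mulr0 (2 * q ^- 2)).
    by apply: cvgM; [exact: cvg_cst|apply: cvg_tail; exact: divr_gt0].
  apply: squeeze_cvgr cv; last exact: cvg_cst.
  near=> x; set u := (x ^+ 2 - 1) / 2.
  have u0 : 0 <= u.
    rewrite divr_ge0// subr_ge0 expr2 -[1]mulr1.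
    by have x1 : 1 <= x by []; rewrite ler_pM.
  clearbody u.
  rewrite mulr_ge0 ?expR_ge0 ?addr_ge0 ?mulr_ge0 ?invr_ge0 ?(ltW q0)//=.
  (* One half of the exponential absorbs the linear factor, as [(1 + u q) / 2 <= exp (u q / 2)]; the
     other half still tends to 0. *)
  have -> : - (u * q) = - (u * (q / 2)) + - (u * (q / 2)) by field.
  rewrite expRD mulrA ler_wpM2r ?expR_ge0//.
  have -> : q^-1 * u + q^-1 * q^-1 = 2 * q ^- 2 * ((1 + u * q) / 2) by field.
  rewrite -[leRHS]mulr1 -mulrA ler_wpM2l ?mulr_ge0 ?invr_ge0 ?sqr_ge0//.
  rewrite expRN ler_pdivrMr ?expR_gt0// mul1r.
  apply: le_trans (expR_ge1Dx _).
  have : 0 <= u * q by rewrite mulr_ge0// ltW.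
  lra.
- by move=> x _; have [] := dF x.
- exact/cvg_at_right_filter/cF.
- by move=> x _; rewrite derive1E; have [] := dF x.
Unshelve. all: by end_near. Qed.

Let cvg_Vpow k : x ^- k.+1 @[x --> +oo] --> (0 : R).
Proof.
have cv : (x : R)^-1 @[x --> +oo] --> (0 : R).
  apply/gtr0_cvgV0; last exact: cvg_id.
  by near=> x.
apply: squeeze_cvgr cv; last exact: cvg_cst.
near=> x; have x1 : 1 <= x by [].
have x0 : 0 < x by rewrite (lt_le_trans ltr01).
rewrite invr_ge0 exprn_ge0 ?(ltW x0)//= lef_pV2 ?posrE ?exprn_gt0//.
by rewrite exprS ler_peMr ?(ltW x0)// exprn_ege1.
Unshelve. all: by end_near. Qed.

Let is_derive_Vpow k (x : R) : x != 0 -> is_derive x 1 (fun x => x ^- k) (- k%:R * x ^- k.+1).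
Proof.
move=> x0; have xk : x ^+ k != 0 by rewrite expf_neq0.
have dX : is_derive x 1 (fun x : R => x ^+ k) (k%:R * x ^+ k.-1).
  apply: DeriveDef; first exact: exprn_derivable.
  by rewrite exp_derive /GRing.scale /= mulr1.
suff <- : - (x ^+ k) ^- 2 *: (k%:R * x ^+ k.-1) = - k%:R * x ^- k.+1.
  exact: (@is_deriveV _ (fun x => x ^+ k) x _ 1 xk dX).
rewrite /GRing.scale /= {dX}.
case: k xk => [|k] xk; first by rewrite !(mul0r, mulr0, oppr0).
by rewrite !exprS /=; field; rewrite expf_neq0 ?x0.
Qed.

Let continuous_Vpow k (x : R) : x != 0 -> {for x, continuous (fun x : R => x ^- k)}.
Proof.
move=> /(is_derive_Vpow k)[d _].
by apply: differentiable_continuous; apply/derivable1_diffP.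
Qed.

Lemma integral_Vpow k : (0 < k)%N ->
  (\int[mu]_(x in `[1%R, +oo[) (x ^- k.+1)%:E = (k%:R^-1)%:E)%E.
Proof.
case: k => // k _; have kn0 : k.+1%:R != 0 :> R by rewrite pnatr_eq0.
pose F (x : R) := - (k.+1%:R^-1 * x ^- k.+1).
have dF (x : R) : x != 0 -> is_derive x 1 F (x ^- k.+2).
  move=> x0; have dV := is_derive_Vpow k.+1 x0.
  apply: is_derive_eq; rewrite /GRing.scale /= ?(scaler0, add0r, addr0).
  by rewrite mulrA mulrN mulVf// mulN1r opprK.
have x0 (x : R) : 1 <= x -> x != 0 by move=> x1; rewrite gt_eqF// (lt_le_trans ltr01).
rewrite (@ge0_continuous_FTC2y _ _ F 1 0).
- by rewrite /F expr1n invr1 mulr1 EFinN sub0e oppeK.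
- by move=> x x1; rewrite invr_ge0 exprn_ge0// (le_trans ler01).
- apply: continuous_in_subspaceT => x; rewrite inE/= in_itv/= andbT => /x0.
  exact: continuous_Vpow.
- have e0 : - (k.+1%:R^-1 * 0) = 0 :> R by rewrite mulr0 oppr0.
  rewrite -[X in _ --> X]e0.
  by apply: (@cvgN _ R^o); apply: cvgM; [exact: cvg_cst|exact: cvg_Vpow].
- by move=> x x1; have [] := dF x (x0 _ (ltW x1)).
- apply: cvg_at_right_filter; apply: (@cvgN _ R^o); apply: cvgM; first exact: cvg_cst.
  exact: (continuous_Vpow (oner_neq0 R)).
- move=> x; rewrite in_itv/= andbT => x1; rewrite derive1E.
  by have [] := dF x (x0 _ (ltW x1)).
Qed.

(** The value is half of [1 / (k - 2) - 1 / k]. This is where [1 / (k (k - 2))] comes from; the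
    integral converges only for [k > 2]. *)
Lemma integral_Vpow2 k : (2 < k)%N ->
  (\int[mu]_(x in `[1%R, +oo[) ((x ^+ 2 - 1) / 2 * x ^- k.+1)%:E =
   ((k%:R * (k%:R - 2))^-1)%:E)%E.
Proof.
case: k => [|[|[|k]]]// _; have kn0 : k.+1%:R != 0 :> R by rewrite pnatr_eq0.
have kn2 : k.+3%:R != 0 :> R by rewrite pnatr_eq0.
have k2 : k.+3%:R - 2 = k.+1%:R :> R by rewrite -(natrB _ (isT : (2 <= k.+3)%N)) subSS subSS subn0.
pose F (x : R) := (2 * k.+3%:R)^-1 * x ^- k.+3 - (2 * k.+1%:R)^-1 * x ^- k.+1.
have dF (x : R) : x != 0 -> is_derive x 1 F ((x ^+ 2 - 1) / 2 * x ^- k.+4).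
  move=> x0; have dV := is_derive_Vpow k.+3 x0; have dW := is_derive_Vpow k.+1 x0.
  apply: is_derive_eq; rewrite /GRing.scale /= ?(scaler0, add0r, addr0).
  have := expf_neq0 k x0; rewrite !exprS.
  have -> : k.+3%:R = k.+1%:R + 2 :> R by rewrite -k2 subrK.
  move: kn0 kn2; rewrite -k2 => {k2 F dV dW}.
  move: (k.+3%:R) (x ^+ k) => b p b2 b0 p0.
  by field; rewrite ?x0 ?p0 ?b0 ?b2 ?subrK ?b0.
have x0 (x : R) : 1 <= x -> x != 0 by move=> x1; rewrite gt_eqF// (lt_le_trans ltr01).
rewrite (@ge0_continuous_FTC2y _ _ F 1 0).
- rewrite /F !expr1n invr1 !mulr1 -EFinB; congr EFin; rewrite k2 sub0r.
  have -> : k.+3%:R = k.+1%:R + 2 :> R by rewrite -k2 subrK.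
  have kn2' : k.+1%:R + 2 != 0 :> R by rewrite -k2 subrK.
  move: kn0 kn2'; move: (k.+1%:R) => b b0 b2.
  by field; rewrite ?b0 ?b2.
- move=> x x1; have xge0 : 0 <= x by rewrite (le_trans ler01).
  rewrite mulr_ge0 ?invr_ge0 ?exprn_ge0//.
  by rewrite divr_ge0// subr_ge0 expr2 -[1]mulr1 ler_pM.
- apply: continuous_in_subspaceT => x; rewrite inE/= in_itv/= andbT => /x0 xn0.
  apply: cvgM; last exact: continuous_Vpow.
  apply: cvgM; last exact: cvg_cst.
  by apply: (@cvgB _ R^o); [exact: exprn_continuous|exact: cvg_cst].
- have e0 : (2 * k.+3%:R)^-1 * 0 - (2 * k.+1%:R)^-1 * 0 = 0 :> R.
    by rewrite !mulr0 subr0.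
  rewrite -[X in _ --> X]e0.
  by apply: (@cvgB _ R^o); apply: cvgM; [exact: cvg_cst|exact: cvg_Vpow|exact: cvg_cst|exact: cvg_Vpow].
- by move=> x x1; have [] := dF x (x0 _ (ltW x1)).
- apply: cvg_at_right_filter; apply: (@cvgB _ R^o); apply: cvgM; first exact: cvg_cst.
  + exact: (continuous_Vpow (oner_neq0 R)).
  + exact: cvg_cst.
  + exact: (continuous_Vpow (oner_neq0 R)).
- move=> x; rewrite in_itv/= andbT => x1; rewrite derive1E.
  by have [] := dF x (x0 _ (ltW x1)).
Qed.

End tail_integrals.

(** * Quadratic functions of a standard Gaussian vector *)

Section bounded_integrals.
Context {R : realType}.

Lemma bounded_integrable d (T : measurableType d) (P : probability T R)
    (f : T -> R) (M : R) : measurable_fun setT f -> (forall t, `|f t| <= M) ->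
  P.-integrable setT (EFin \o f).
Proof.
move=> mf fM; apply: (le_integrable measurableT _ _ (finite_measure_integrable_cst P M measurableT)).
  exact/measurable_EFinP.
by move=> t _ /=; rewrite lee_fin (le_trans (fM t))// ler_norm.
Qed.

Lemma bounded_Rintegral_Fubini d1 d2 (T1 : measurableType d1)
    (T2 : measurableType d2) (P1 : probability T1 R) (P2 : probability T2 R)
    (f : T1 * T2 -> R) (M : R) : measurable_fun setT f ->
  (forall z, `|f z| <= M) ->
  (\int[P1]_x (\int[P2]_y f (x, y)) = \int[P2]_y (\int[P1]_x f (x, y)))%R.
Proof.
move=> mf fM.
have if_ : (P1 \x P2)%E.-integrable setT (EFin \o f).
  exact: (@bounded_integrable _ _ (P1 \x P2)%E f M).
have i1 x : P2.-integrable setT (EFin \o (fun y => f (x, y))).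
  apply: (@bounded_integrable _ _ _ _ M) => //.
  by apply: measurableT_comp => //; exact: measurable_pair1.
have i2 y : P1.-integrable setT (EFin \o (fun x => f (x, y))).
  apply: (@bounded_integrable _ _ _ _ M) => //.
  by apply: measurableT_comp => //; exact: measurable_pair2.
rewrite /Rintegral; congr fine.
have E1 x : (fine (\int[P2]_y (f (x, y))%:E))%:E = (\int[P2]_y (f (x, y))%:E)%E.
  by rewrite fineK//; exact: integrable_fin_num (i1 x).
have E2 y : (fine (\int[P1]_x (f (x, y))%:E))%:E = (\int[P1]_x (f (x, y))%:E)%E.
  by rewrite fineK//; exact: integrable_fin_num (i2 y).
under eq_integral do rewrite E1.
under [RHS]eq_integral do rewrite E2.
exact: (Fubini if_).
Qed.

End bounded_integrals.

Section standard_gaussian.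
Context {R : realType}.
Notation gamma := (normal_prob (0 : R) 1).

Lemma Rintegral_normal_prob01 (f : R -> R) M : measurable_fun [set: R] f ->
  (forall t, `|f t| <= M) ->
  (\int[gamma]_t f t = \int[lebesgue_measure]_t (f t * normal_pdf 0 1 t))%R.
Proof.
move=> mf fM; rewrite /Rintegral integral_normal_prob//.
  exact/measurable_EFinP.
have /integrableP[_] : gamma.-integrable setT (EFin \o f).
  exact: (@bounded_integrable _ _ _ gamma f M).
by [].
Qed.

Lemma Rintegral_cos_normal_prob01 (c : R) :
  (\int[gamma]_t cos (c * t))%R = expR (- c ^+ 2 / 2).
Proof.
rewrite (@Rintegral_normal_prob01 _ 1) ?integral_cos_normal_pdf01//.
  by apply: measurableT_comp; [exact: continuous_measurable_cos|exact: measurable_funM].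
by move=> t; exact: cos_max.
Qed.

Lemma Rintegral_expR_normal_prob01 (x : R) : 1 <= x ->
  (\int[gamma]_t expR (- (x ^+ 2 - 1) / 2 * t ^+ 2))%R = x^-1.
Proof.
move=> x1; rewrite (@Rintegral_normal_prob01 _ 1).
- by rewrite integral_expR_normal_pdf01// (lt_le_trans ltr01).
- by apply: measurableT_comp => //; exact: measurable_funM.
- move=> t; rewrite ger0_norm ?expR_ge0// expR_le1 mulNr mulNr oppr_le0.
  rewrite mulr_ge0 ?sqr_ge0// divr_ge0// subr_ge0 expr2.
  by rewrite -[1]mulr1 ler_pM.
Qed.

(** Laplace kernel, parametrised so that its mean over [s] under [N(0,1)] is [x^-1]. *)
Definition gfac (x s : R) : R := expR (- (x ^+ 2 - 1) / 2 * s ^+ 2).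

Lemma gfac_ge0 x s : 0 <= gfac x s. Proof. exact: expR_ge0. Qed.
Lemma gfac_le1 x s : 1 <= x -> gfac x s <= 1.
Proof.
move=> x1; rewrite /gfac expR_le1 mulNr mulNr oppr_le0.
rewrite mulr_ge0 ?sqr_ge0// divr_ge0// subr_ge0 expr2.
by rewrite -[1]mulr1 ler_pM.
Qed.

Context d (T : measurableType d) (P : probability T R) (m : nat).
Variable Z : T -> 'cV[R]_m.

Definition std_gaussian_vec :=
  (forall j, measurable_fun setT (fun t => Z t j 0)) /\
  (forall u, dotv u u = 1 -> forall B : set R, measurable B ->
     P ((fun t => dotv u (Z t)) @^-1` B) = gamma B).

Hypothesis gZ : std_gaussian_vec.

Lemma measurable_dotv_std_gaussian a : measurable_fun setT (fun t => dotv a (Z t)).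
Proof.
rewrite (_ : (fun _ => _) = (fun t => \sum_i a i 0 * Z t i 0)).
  by apply: measurable_sum => i; apply: measurable_funM => //; exact: gZ.1.
by apply/funext => t; rewrite dotvE.
Qed.

Lemma integral_cos_dotv a :
  (\int[P]_t cos (dotv a (Z t)))%R = expR (- dotv a a / 2).
Proof.
have [->|a0] := eqVneq a 0.
  rewrite dotv0l oppr0 mul0r expR0.
  under eq_Rintegral do rewrite dotv0l cos0.
  have P1 : fine (P setT) = 1 by rewrite probability_setT.
  by rewrite Rintegral_cst// mul1r; exact: P1.
have aa : 0 < dotv a a by rewrite lt_def dotvv_eq0 a0 dotvv_ge0.
pose r := Num.sqrt (dotv a a).
have r0 : r != 0 by rewrite gt_eqF// sqrtr_gt0.
have rr : r ^+ 2 = dotv a a by rewrite sqr_sqrtr ?ltW.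
pose u := r^-1 *: a.
have uu : dotv u u = 1 by rewrite dotvZl dotvZr -rr; field.
have aE t : dotv a (Z t) = r * dotv u (Z t) by rewrite dotvZl mulVKf.
under eq_Rintegral do rewrite aE.
rewrite -rr -Rintegral_cos_normal_prob01.
have mu_ := measurable_dotv_std_gaussian u.
have mc : measurable_fun [set: R] (fun x : R => cos (r * x)).
  by apply: measurableT_comp; [exact: continuous_measurable_cos|exact: measurable_funM].
have mu' : measurable_fun setT ((fun t => dotv u (Z t)) : T -> measurableTypeR R).
  exact: mu_.
have mc' : measurable_fun setT ((fun x => (cos (r * x))%:E) : measurableTypeR R -> \bar R).
  by apply/measurable_EFinP; exact: mc.
rewrite /Rintegral; congr fine; symmetry.
transitivity (\int[pushforward P ((fun t => dotv u (Z t)) : T -> measurableTypeR R)]_x (cos (r * x))%:E)%E.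
  apply: eq_measure_integral => A mA _.
  exact: (esym (gZ.2 u uu A mA)).
rewrite integral_pushforward//=.
apply: (@bounded_integrable _ _ _ _ _ 1).
  exact: (measurableT_comp mc mu_).
by move=> t; exact: cos_max.
Qed.

Lemma measurable_gfac x a : measurable_fun setT (fun t => gfac x (dotv a (Z t))).
Proof.
rewrite /gfac; apply: measurableT_comp => //; apply: measurable_funM => //.
by apply: measurable_funX; exact: measurable_dotv_std_gaussian.
Qed.

(* [exp (- (x^2 - 1) s^2 / 2)] is the mixture of the [cos (b tau s)],
   [b = sqrt (x^2 - 1)], over a standard Gaussian [tau], so the expectation
   involves only the laws of linear functionals of [Z]. *)
Lemma std_gaussian_laplace us (x : 'cV[R]_m -> R) a : orthonormal us ->
  (forall u, 1 <= x u) -> (forall u, u \in us -> dotv a u = 0) ->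
  (\int[P]_t (cos (dotv a (Z t)) * \prod_(u <- us) gfac (x u) (dotv u (Z t))))%R =
  expR (- dotv a a / 2) * \prod_(u <- us) (x u)^-1.
Proof.
move=> + x1; elim: us a => [|u us IH] a.
  move=> _ _; rewrite big_nil mulr1 -integral_cos_dotv.
  by apply: eq_Rintegral => t _; rewrite big_nil mulr1.
move=> [uu u0 ous] a0.
have au : dotv a u = 0 by apply: a0; rewrite mem_head.
pose b := Num.sqrt (x u ^+ 2 - 1).
have bb : b ^+ 2 = x u ^+ 2 - 1.
  by rewrite sqr_sqrtr// subr_ge0 expr2 -[1]mulr1 ler_pM.
pose G t := \prod_(u <- us) gfac (x u) (dotv u (Z t)).
have mG : measurable_fun setT G.
  by apply: measurable_prod => w _; exact: measurable_gfac.
have G0 t : 0 <= G t by apply: prodr_ge0 => w _; exact: gfac_ge0.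
have G1 t : G t <= 1.
  by apply: prodr_ile1 => w _; rewrite gfac_ge0 gfac_le1.
pose f (z : T * measurableTypeR R) :=
  cos (dotv a (Z z.1)) * G z.1 * cos (b * dotv u (Z z.1) * z.2).
have mcosa c : measurable_fun setT (fun t => cos (dotv c (Z t))).
  by apply: measurableT_comp; [exact: continuous_measurable_cos|exact: measurable_dotv_std_gaussian].
have fM z : `|f z| <= 1.
  rewrite /f !normrM (ger0_norm (G0 _)).
  apply: mulr_ile1; rewrite ?mulr_ge0//; last exact: cos_max.
  by apply: mulr_ile1 => //; exact: cos_max.
have msnd : measurable_fun setT (fun z : T * measurableTypeR R => z.2 : R).
  exact: measurable_snd.
have mf : measurable_fun setT f.
  apply: measurable_funM; first apply: measurable_funM.
  - exact: (measurableT_comp (mcosa a) measurable_fst).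
  - exact: (measurableT_comp mG measurable_fst).
  - apply: measurableT_comp; first exact: continuous_measurable_cos.
    apply: measurable_funM => //; apply: measurable_funM => //.
    exact: (measurableT_comp (measurable_dotv_std_gaussian u) measurable_fst).
have -> : (\int[P]_t (cos (dotv a (Z t)) *
      \prod_(w <- u :: us) gfac (x w) (dotv w (Z t))) =
    \int[P]_t (\int[gamma]_y f (t, y)))%R.
  apply: eq_Rintegral => t _; rewrite /f /= RintegralZl//; last first.
    apply: (@bounded_integrable _ _ _ _ _ 1) => [|y]; last exact: cos_max.
    apply: measurableT_comp; first exact: continuous_measurable_cos.
    exact: measurable_funM.
  rewrite Rintegral_cos_normal_prob01 big_cons -/(G t).
  rewrite -mulrA [G t * _]mulrC; congr (_ * (expR _ * _)).
  by rewrite exprMn bb; ring.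
rewrite (bounded_Rintegral_Fubini P gamma mf fM).
have fE (y : R) : (\int[P]_t f (t, y))%R =
    (expR (- dotv a a / 2) * \prod_(w <- us) (x w)^-1) * gfac (x u) y.
  (* The product of two cosines is the half sum of cosines of the functionals [a + c y u], with [c]
     equal to [b] or [- b]. Both are orthogonal to [us], so the induction hypothesis applies; since
     [a] is orthogonal to [u], the squared norm is [|a|^2 + b^2 y^2], and its second term yields
     [gfac (x u) y]. *)
  have E (c : R) : c ^+ 2 = b ^+ 2 -> (\int[P]_t (cos (dotv (a + (c * y) *: u) (Z t)) * G t))%R =
      expR (- dotv a a / 2) * \prod_(w <- us) (x w)^-1 * gfac (x u) y.
    move=> cb; rewrite IH//; last first.
      move=> w wus; rewrite dotvDl dotvZl u0// mulr0 addr0 a0// inE wus.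
      by rewrite orbT.
    rewrite mulrAC /gfac -expRD; congr (expR _ * _).
    rewrite dotvDl !dotvDr !dotvZl !dotvZr uu (dotvC u a) au.
    have -> : c * y * (c * y * 1) = (x u ^+ 2 - 1) * y ^+ 2 by rewrite -bb -cb; ring.
    by field.
  have iE (c : R) : P.-integrable setT (EFin \o (fun t => cos (dotv (a + (c * y) *: u) (Z t)) * G t)).
    apply: (@bounded_integrable _ _ _ _ _ 1).
      by apply: measurable_funM => //; exact: mcosa.
    move=> t; rewrite normrM (ger0_norm (G0 t)).
    by apply: mulr_ile1 => //; exact: cos_max.
  transitivity (\int[P]_t (2^-1 * (cos (dotv (a + (b * y) *: u) (Z t)) * G t +
      cos (dotv (a + (- b * y) *: u) (Z t)) * G t)))%R.
    apply: eq_Rintegral => t _; rewrite /f /= !dotvDl !dotvZl mulNr mulNr.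
    by rewrite cosB cosD mulrAC [b * y * _]mulrAC; field.
  rewrite RintegralZl//; last first.
    rewrite (_ : _ \o _ = (fun t => (cos (dotv (a + (b * y) *: u) (Z t)) * G t)%:E +
       (cos (dotv (a + (- b * y) *: u) (Z t)) * G t)%:E)%E)//.
    by apply: integrableD => //; exact: iE.
  rewrite RintegralD; [|by []|exact: iE..].
  by rewrite !E ?sqrrN//; field.
under eq_Rintegral do rewrite fE.
rewrite RintegralZl//; last first.
  apply: (@bounded_integrable _ _ _ _ _ 1) => [|y].
    by apply: measurableT_comp => //; exact: measurable_funM.
  by rewrite ger0_norm ?gfac_ge0// gfac_le1.
by rewrite Rintegral_expR_normal_prob01// big_cons mulrAC mulrA.
Qed.

End standard_gaussian.

(** * Expectations of ratios of quadratic functions *)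

Section gaussian_ratios.
Context {R : realType} d (T : measurableType d) (P : probability T R) (m : nat).
Variable Z : T -> 'cV[R]_m.
Hypothesis gZ : std_gaussian_vec P Z.
Notation mu := (@lebesgue_measure R).

Definition sqsum (us : seq 'cV[R]_m) (t : T) : R :=
  \sum_(w <- us) dotv w (Z t) ^+ 2.

Lemma sqsum_ge0 us t : 0 <= sqsum us t.
Proof. by apply: sumr_ge0 => w _; exact: sqr_ge0. Qed.

Lemma measurable_sqsum us : measurable_fun setT (sqsum us).
Proof.
apply: measurable_sum => w; apply: measurable_funX.
exact: (measurable_dotv_std_gaussian gZ).
Qed.

Lemma sqsum_ge us u t : u \in us -> dotv u (Z t) ^+ 2 <= sqsum us t.
Proof.
move=> uus; rewrite /sqsum (big_rem u)//= lerDl.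
by apply: sumr_ge0 => w _; exact: sqr_ge0.
Qed.

Lemma prod_gfac us (x : R) t :
  \prod_(w <- us) gfac x (dotv w (Z t)) = expR (- ((x ^+ 2 - 1) / 2 * sqsum us t)).
Proof.
by rewrite /gfac -expR_sum -mulr_sumr -/(sqsum us t) mulNr mulNr.
Qed.

Lemma integral_prod_gfac us (x : 'cV[R]_m -> R) : orthonormal us ->
  (forall u, 1 <= x u) ->
  (\int[P]_t (\prod_(w <- us) gfac (x w) (dotv w (Z t)))%:E =
   (\prod_(w <- us) (x w)^-1)%:E)%E.
Proof.
move=> ous x1.
have iG : P.-integrable setT (EFin \o (fun t => \prod_(w <- us) gfac (x w) (dotv w (Z t)))).
  apply: (@bounded_integrable _ _ _ _ _ 1).
    by apply: measurable_prod => w _; exact: (measurable_gfac gZ).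
  move=> t; rewrite ger0_norm ?prodr_ge0// => [|w _]; last exact: gfac_ge0.
  by apply: prodr_ile1 => w _; rewrite gfac_ge0 gfac_le1.
rewrite -(fineK (integrable_fin_num measurableT iG)); congr EFin.
have := std_gaussian_laplace gZ ous x1 (fun u _ => dotv0l u).
rewrite dotv0l oppr0 mul0r expR0 mul1r => <-.
by apply: eq_Rintegral => t _; rewrite dotv0l cos0 mul1r.
Qed.

(** The unbounded factor [s^2], with [s = dotv u (Z t)], is reached by a difference quotient:
    [1 + r s^2 <= exp (r s^2)] gives [s^2 exp (- r s^2) <= (1 - exp (- r s^2)) / r]. With
    [r = (x^2 - y^2) / 2], the factor [exp (- r s^2)] raises the parameter from [y] to [x] in the
    direction [u] alone. For [k = size us] the expectation is thus at most
    [(y^-1 - x^-1) / r * y^-(k-1)], which is at most [y^-(k+2)]. *)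
Let integral_sq_laplace_lt us u (x y : R) : orthonormal us -> u \in us ->
  1 <= y -> y < x ->
  (\int[P]_t (dotv u (Z t) ^+ 2 *
      expR (- ((x ^+ 2 - 1) / 2 * sqsum us t)))%:E <= (y ^- (size us).+2)%:E)%E.
Proof.
move=> ous uus y1 yx.
have y0 : 0 < y by rewrite (lt_le_trans ltr01).
have x0 : 0 < x by rewrite (lt_trans y0).
pose r := (x ^+ 2 - y ^+ 2) / 2.
have r0 : 0 < r by rewrite divr_gt0// subr_gt0 ltrXn2r// ?nnegrE ltW.
pose xs (w : 'cV[R]_m) := if w == u then x else y.
have xs1 w : 1 <= xs w by rewrite /xs; case: ifP => // _; rewrite (le_trans y1)// ltW.
have xsu : xs u = x by rewrite /xs eqxx.
have uus' := orthonormal_uniq ous.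
have rem_ne w : w \in rem u us -> (w == u) = false.
  by rewrite mem_rem_uniq// inE => /andP[/negbTE].
pose G t := \prod_(w <- us) gfac y (dotv w (Z t)).
pose H t := \prod_(w <- us) gfac (xs w) (dotv w (Z t)).
have HG t : H t = expR (- (r * dotv u (Z t) ^+ 2)) * G t.
  rewrite /H /G (big_rem u)//= [in RHS](big_rem u)//= mulrA.
  congr (_ * _); last first.
    by apply: eq_big_seq => w /rem_ne; rewrite /xs => ->.
  by rewrite /xs eqxx /gfac -expRD; congr expR; rewrite /r; field.
have mG : measurable_fun setT G.
  by apply: measurable_prod => w _; exact: (measurable_gfac gZ).
have mH : measurable_fun setT H.
  by apply: measurable_prod => w _; exact: (measurable_gfac gZ).
have G0 t : 0 <= G t by apply: prodr_ge0 => w _; exact: gfac_ge0.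
have G1 t : G t <= 1 by apply: prodr_ile1 => w _; rewrite gfac_ge0 gfac_le1.
have H0 t : 0 <= H t by apply: prodr_ge0 => w _; exact: gfac_ge0.
have H1 t : H t <= 1 by apply: prodr_ile1 => w _; rewrite gfac_ge0 gfac_le1.
have iG : P.-integrable setT (EFin \o G).
  by apply: (@bounded_integrable _ _ _ _ _ 1) => // t; rewrite ger0_norm.
have iH : P.-integrable setT (EFin \o H).
  by apply: (@bounded_integrable _ _ _ _ _ 1) => // t; rewrite ger0_norm.
have mu_ : measurable_fun setT (fun t => dotv u (Z t)).
  exact: (measurable_dotv_std_gaussian gZ).
apply: (@le_trans _ _ (\int[P]_t (r^-1%:E * ((G t)%:E - (H t)%:E)))%E).
  apply: ge0_le_integral => //.
  - by move=> t _; rewrite lee_fin mulr_ge0 ?sqr_ge0 ?expR_ge0.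
  - apply/measurable_EFinP; apply: measurable_funM; first exact: measurable_funX.
    apply: measurableT_comp => //; apply: measurableT_comp => //.
    by apply: measurable_funM => //; exact: measurable_sqsum.
  - apply: emeasurable_funM => //; apply: emeasurable_funB;
      exact/measurable_EFinP.
  - move=> t _; rewrite -EFinB -EFinM lee_fin HG.
    set s := dotv u (Z t).
    have -> : G t - expR (- (r * s ^+ 2)) * G t = (1 - expR (- (r * s ^+ 2))) * G t.
      by rewrite mulrBl mul1r.
    have E1 : expR (- ((x ^+ 2 - 1) / 2 * sqsum us t)) <= expR (- (r * s ^+ 2)) * G t.
      rewrite /G prod_gfac -expRD ler_expR -opprD lerN2.
      have := sqsum_ge t uus; rewrite -/s => /(ler_wpM2l (ltW r0)) sq.
      apply: (le_trans (lerD sq (lexx _))); rewrite le_eqVlt; apply/orP; left.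
      by apply/eqP; rewrite /r; field.
    apply: (le_trans (ler_wpM2l (sqr_ge0 s) E1)).
    rewrite !mulrA ler_wpM2r// [leRHS]mulrC ler_pdivlMr//.
    have : (1 + r * s * s) * expR (- (r * s * s)) <= 1.
      by rewrite -[leRHS](expRxMexpNx_1 (r * s * s)) ler_wpM2r ?expR_ge0 ?expR_ge1Dx.
    lra.
rewrite ge0_integralZl//; last 3 first.
- apply: emeasurable_funB; exact/measurable_EFinP.
- move=> t _; rewrite -EFinB lee_fin subr_ge0 HG ler_piMl// expR_le1.
  by rewrite oppr_le0 mulr_ge0 ?sqr_ge0 ?ltW.
- by rewrite lee_fin invr_ge0 ltW.
rewrite integralB// !integral_prod_gfac// -EFinB -EFinM lee_fin.
rewrite (big_rem u)//= [X in _ - X](big_rem u)//= xsu.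
rewrite [X in _ - _ * X](eq_big_seq (fun=> y^-1)); last first.
  by move=> w /rem_ne; rewrite /xs => ->.
rewrite big_const_seq count_predT iter_mulr_1 size_rem// -mulrBl.
have -> : y ^- (size us).+2 = y^-1 ^+ 3 * y^-1 ^+ (size us).-1.
  rewrite -exprD -exprVn; congr (_ ^+ _).
  by case: us uus {ous xs xs1 xsu uus' rem_ne G H HG mG mH G0 G1 H0 H1 iG iH}.
rewrite mulrA ler_wpM2r ?exprn_ge0 ?invr_ge0 ?(ltW y0)//.
have -> : r^-1 * (y^-1 - x^-1) = 2 / (x * y * (x + y)).
  rewrite /r; field; rewrite ?(gt_eqF y0) ?(gt_eqF x0) ?subr_eq0 ?gt_eqF ?addr_gt0//.
  by rewrite ltrXn2r// ?nnegrE ltW.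
have -> : y^-1 ^+ 3 = 2 / (y * y * (y + y)).
  have yn0 : y != 0 by rewrite gt_eqF.
  have -> : y + y = 2 * y by ring.
  by field.
rewrite ler_pM2l// lef_pV2 ?posrE ?mulr_gt0 ?addr_gt0//.
by rewrite ler_pM ?mulr_ge0 ?addr_ge0 ?(ltW x0) ?(ltW y0) ?ler_wpM2r ?lerD ?(ltW yx) ?(ltW y0).
Qed.

(** The left side does not involve [y], so [y] may tend to [x] from below; [1 < x] leaves room for
    [1 <= y < x]. *)
Lemma integral_sq_laplace us u (x : R) : orthonormal us -> u \in us -> 1 < x ->
  (\int[P]_t (dotv u (Z t) ^+ 2 *
      expR (- ((x ^+ 2 - 1) / 2 * sqsum us t)))%:E <= (x ^- (size us).+2)%:E)%E.
Proof.
move=> ous uus x1; set I := (\int[P]_t _)%E.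
have I0 : (0 <= I)%E.
  by apply: integral_ge0 => t _; rewrite lee_fin mulr_ge0 ?sqr_ge0 ?expR_ge0.
have Ile y : 1 <= y -> y < x -> (I <= (y ^- (size us).+2)%:E)%E.
  exact: integral_sq_laplace_lt.
have Ifin : I \is a fin_num.
  by rewrite ge0_fin_numE// (le_lt_trans (Ile 1 (lexx _) x1))// ltry.
rewrite -(fineK Ifin) lee_fin.
have x0 : x != 0 by rewrite gt_eqF// (lt_trans ltr01).
have cV : y ^- (size us).+2 @[y --> x^'-] --> x ^- (size us).+2.
  apply: cvg_at_left_filter; apply: cvgV; first by rewrite expf_neq0.
  exact: exprn_continuous.
apply: (cvgr_to_ge cV); near=> y.
rewrite -lee_fin fineK//; apply: Ile; last by near: y; exact: nbhs_left_lt.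
by apply: ltW; near: y; exact: nbhs_left_gt.
Unshelve. all: by end_near. Qed.

(* Writing a negative power of [|y|^2] as a mixture of the [exp (- s |y|^2)],
   with [s = (x^2 - 1) / 2], turns the expectation into a one-dimensional
   integral. *)
Let tonelli_laplace_le (g : T -> R -> R) (h : R -> R) :
  measurable_fun setT (fun z : T * measurableTypeR R => g z.1 z.2) ->
  (forall t x, 1 < x -> 0 <= g t x) ->
  measurable_fun (`]1%R, +oo[%classic : set R) h ->
  (forall x, 1 < x -> (\int[P]_t (g t x)%:E <= (h x)%:E)%E) ->
  (\int[P]_t \int[mu]_(x in `]1%R, +oo[) (g t x)%:E <=
   \int[mu]_(x in `]1%R, +oo[) (h x)%:E)%E.
Proof.
move=> mg g0 mh gh.
pose D : set (measurableTypeR R) := `]1, +oo[%classic.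
have mD : measurable D by exact: measurable_itv.
pose f (z : T * measurableTypeR R) : \bar R := (g z.1 z.2 * \1_D z.2)%:E.
have mf : measurable_fun setT f.
  apply/measurable_EFinP; apply: measurable_funM => //.
  apply: (measurableT_comp (f := \1_D : measurableTypeR R -> R)) => //.
have f0 z : (0 <= f z)%E.
  rewrite lee_fin /f indicE; case: (boolP (z.2 \in D)) => [|_]; last by rewrite mulr0.
  by rewrite inE /D /= in_itv /= andbT mulr1 => /g0.
have fE t : (\int[mu]_(x in `]1%R, +oo[) (g t x)%:E = \int[mu]_x f (t, x))%E.
  rewrite integral_mkcond; apply: eq_integral => x _.
  by rewrite epatch_indic /f /= EFinM.
under eq_integral do rewrite fE.
rewrite (fubini_tonelli f mf f0).
have -> : (\int[mu]_y \int[P]_x f (x, y) =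
    \int[mu]_(y in D) \int[P]_x f (x, y))%E.
  rewrite [RHS]integral_mkcond; apply: eq_integral => x _.
  rewrite patchE; case: ifPn => // xD; apply: integral0_eq => t _.
  by rewrite /f /= indicE (negbTE xD) mulr0.
apply: ge0_le_integral => //.
- by move=> x _; exact: integral_ge0.
- apply: measurable_funTS; exact: (measurable_fun_fubini_tonelli_G f mf f0).
- exact/measurable_EFinP.
- move=> x Dx; apply: le_trans (gh x _); last first.
    by move: Dx; rewrite /D /= in_itv /= andbT.
  by rewrite le_eqVlt; apply/orP; left; apply/eqP; apply: eq_integral => t _;
    rewrite /f /= indicE mem_set// mulr1.
Qed.

Let measurable_itv_Vpow k : measurable_fun (`]1%R, +oo[%classic : set R) (fun x : R => x ^- k).
Proof.
apply: (@eq_measurable_fun _ _ _ _ _ (fun x => (x `^ (-1)) ^+ k)).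
  move=> x; rewrite inE /= in_itv /= andbT => x1.
  by rewrite powR_inv1 ?exprVn// (le_trans ler01 (ltW x1)).
apply: measurable_funTS; apply: measurable_funX; exact: measurable_powR.
Qed.

(** With [k = size us], the Laplace bound leaves the integral of [x * x^-(k+2)] over [x > 1], that
    is [1/k]: the share that symmetry assigns to each of [k] coordinates. *)
Lemma integral_sq_ratio_le us u : orthonormal us -> u \in us ->
  (\int[P]_t (dotv u (Z t) ^+ 2 / sqsum us t)%:E <= ((size us)%:R^-1)%:E)%E.
Proof.
move=> ous uus; have us0 : (0 < size us)%N by case: us uus {ous}.
pose g t (x : R) := dotv u (Z t) ^+ 2 * (x * expR (- ((x ^+ 2 - 1) / 2 * sqsum us t))).
have gE t : ((dotv u (Z t) ^+ 2 / sqsum us t)%:E =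
    \int[mu]_(x in `]1%R, +oo[) (g t x)%:E)%E.
  have [q0|q0] := eqVneq (sqsum us t) 0.
    have u0 : dotv u (Z t) ^+ 2 = 0.
      by apply/eqP; rewrite eq_le sqr_ge0 andbT -q0 sqsum_ge.
    by rewrite u0 mul0r integral0_eq// => x _; rewrite /g u0 mul0r.
  have qgt0 : 0 < sqsum us t by rewrite lt_def q0 sqsum_ge0.
  have mx : measurable_fun setT (fun x : R => x * expR (- ((x ^+ 2 - 1) / 2 * sqsum us t))).
    apply: measurable_funM => //; apply: measurableT_comp => //.
    apply: measurableT_comp => //; apply: measurable_funM => //.
    by apply: measurable_funM => //; exact: measurable_funB.
  under eq_integral do rewrite /g EFinM.
  rewrite ge0_integralZl//; last 3 first.
  - by apply/measurable_EFinP; exact: measurable_funTS.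
  - move=> x /=; rewrite in_itv /= andbT => x1.
    by rewrite lee_fin mulr_ge0 ?expR_ge0// (le_trans ler01 (ltW x1)).
  - by rewrite lee_fin sqr_ge0.
  (* The half-line is open at 1 because the Laplace bound is stated for [1 < x]; the endpoint is a
     null set. *)
  rewrite integral_itv_obnd_cbnd; last by apply/measurable_EFinP; exact: measurable_funTS.
  by rewrite integral_laplace_inv// -EFinM.
under eq_integral do rewrite gE.
rewrite -(integral_Vpow us0) -integral_itv_obnd_cbnd; last first.
  by apply/measurable_EFinP; exact: measurable_itv_Vpow.
apply: tonelli_laplace_le => //; last 2 first.
- move=> t x x1; rewrite mulr_ge0 ?sqr_ge0// mulr_ge0 ?expR_ge0//.
  by rewrite (le_trans ler01 (ltW x1)).
- move=> x x1; have x0 : 0 < x by rewrite (lt_trans ltr01).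
  under eq_integral do rewrite /g mulrCA EFinM.
  have mu_ := measurable_dotv_std_gaussian gZ u.
  have ms := measurable_sqsum us.
  rewrite ge0_integralZl//; last 3 first.
  + apply/measurable_EFinP; apply: measurable_funM; first exact: measurable_funX.
    apply: measurableT_comp => //; apply: measurableT_comp => //.
    exact: measurable_funM.
  + by move=> t _; rewrite lee_fin mulr_ge0 ?sqr_ge0 ?expR_ge0.
  + by rewrite lee_fin ltW.
  apply: (@le_trans _ _ (x%:E * (x ^- (size us).+2)%:E)%E).
    apply: lee_wpmul2l; first by rewrite lee_fin ltW.
    exact: integral_sq_laplace.
  by rewrite -EFinM lee_fin [in leLHS]exprS invfM mulVKf// gt_eqF.
- have mu_ := measurable_dotv_std_gaussian gZ u.
  have ms := measurable_sqsum us.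
  have m2 : measurable_fun setT (fun z : T * measurableTypeR R => z.2 : R).
    exact: measurable_snd.
  apply: measurable_funM.
    apply: measurable_funX; exact: (measurableT_comp mu_ measurable_fst).
  apply: measurable_funM => //; apply: measurableT_comp => //.
  apply: measurableT_comp => //; apply: measurable_funM.
    apply: measurable_funM => //; apply: measurable_funB => //.
    exact: measurable_funX.
  exact: (measurableT_comp ms measurable_fst).
Qed.

Lemma integral_sq_ratio2_le us u : orthonormal us -> u \in us ->
  (2 < size us)%N ->
  (\int[P]_t (dotv u (Z t) ^+ 2 / sqsum us t ^+ 2)%:E <=
   (((size us)%:R * ((size us)%:R - 2))^-1)%:E)%E.
Proof.
move=> ous uus us2.
pose g t (x : R) := dotv u (Z t) ^+ 2 *
  (x * ((x ^+ 2 - 1) / 2) * expR (- ((x ^+ 2 - 1) / 2 * sqsum us t))).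
have x2 (x : R) : 1 < x -> 0 <= (x ^+ 2 - 1) / 2.
  by move=> x1; rewrite divr_ge0// subr_ge0 expr2 -[1]mulr1 ler_pM// ltW.
have gE t : ((dotv u (Z t) ^+ 2 / sqsum us t ^+ 2)%:E =
    \int[mu]_(x in `]1%R, +oo[) (g t x)%:E)%E.
  have [q0|q0] := eqVneq (sqsum us t) 0.
    have u0 : dotv u (Z t) ^+ 2 = 0.
      by apply/eqP; rewrite eq_le sqr_ge0 andbT -q0 sqsum_ge.
    by rewrite u0 mul0r integral0_eq// => x _; rewrite /g u0 mul0r.
  have qgt0 : 0 < sqsum us t by rewrite lt_def q0 sqsum_ge0.
  have mx : measurable_fun setT (fun x : R => x * ((x ^+ 2 - 1) / 2) * expR (- ((x ^+ 2 - 1) / 2 * sqsum us t))).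
    have m1 : measurable_fun setT (fun x : R => (x ^+ 2 - 1) / 2).
      by apply: measurable_funM => //; exact: measurable_funB.
    apply: measurable_funM; first exact: measurable_funM.
    apply: measurableT_comp => //; apply: measurableT_comp => //.
    exact: measurable_funM.
  under eq_integral do rewrite /g EFinM.
  rewrite ge0_integralZl//; last 3 first.
  - by apply/measurable_EFinP; exact: measurable_funTS.
  - move=> x /=; rewrite in_itv /= andbT => x1.
    by rewrite lee_fin mulr_ge0 ?expR_ge0// mulr_ge0 ?x2// (le_trans ler01 (ltW x1)).
  - by rewrite lee_fin sqr_ge0.
  rewrite integral_itv_obnd_cbnd; last by apply/measurable_EFinP; exact: measurable_funTS.
  by rewrite integral_laplace_inv2// -EFinM.
under eq_integral do rewrite gE.
have mh : measurable_fun (`]1%R, +oo[%classic : set R) (fun x : R => (x ^+ 2 - 1) / 2 * x ^- (size us).+1).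
  apply: measurable_funM; last exact: measurable_itv_Vpow.
  by apply: measurable_funTS; apply: measurable_funM => //; exact: measurable_funB.
rewrite -(integral_Vpow2 us2) -integral_itv_obnd_cbnd; last exact/measurable_EFinP.
apply: tonelli_laplace_le => //; last first.
- move=> x x1; have x0 : 0 < x by rewrite (lt_trans ltr01).
  under eq_integral do rewrite /g mulrCA EFinM.
  have mu_ := measurable_dotv_std_gaussian gZ u.
  have ms := measurable_sqsum us.
  have xx0 : 0 <= x * ((x ^+ 2 - 1) / 2) by rewrite mulr_ge0 ?x2 ?ltW.
  rewrite ge0_integralZl//; last 2 first.
  + apply/measurable_EFinP; apply: measurable_funM; first exact: measurable_funX.
    apply: measurableT_comp => //; apply: measurableT_comp => //.
    exact: measurable_funM.
  + by move=> t _; rewrite lee_fin mulr_ge0 ?sqr_ge0 ?expR_ge0.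
  apply: (@le_trans _ _ ((x * ((x ^+ 2 - 1) / 2))%:E * (x ^- (size us).+2)%:E)%E).
    apply: lee_wpmul2l; first by rewrite lee_fin.
    exact: integral_sq_laplace.
  rewrite -EFinM lee_fin [in leLHS]exprS invfM mulrAC mulVKf ?gt_eqF//.
  by rewrite mulrC.
- move=> t x x1; rewrite mulr_ge0 ?sqr_ge0// mulr_ge0 ?expR_ge0// mulr_ge0 ?x2//.
  by rewrite (le_trans ler01 (ltW x1)).
- have mu_ := measurable_dotv_std_gaussian gZ u.
  have ms := measurable_sqsum us.
  have m2 : measurable_fun setT (fun z : T * measurableTypeR R => z.2 : R).
    exact: measurable_snd.
  have m3 : measurable_fun setT (fun z : T * measurableTypeR R => (z.2 ^+ 2 - 1) / 2).
    by apply: measurable_funM => //; apply: measurable_funB => //; exact: measurable_funX.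
  apply: measurable_funM.
    apply: measurable_funX; exact: (measurableT_comp mu_ measurable_fst).
  apply: measurable_funM; first exact: measurable_funM.
  apply: measurableT_comp => //.
  apply: measurableT_comp => //; apply: measurable_funM => //.
  exact: (measurableT_comp ms measurable_fst).
Qed.

End gaussian_ratios.

Section measurable_matrix.
Context {R : realType} d (T : measurableType d).

Lemma measurable_funVr (f : T -> R) : measurable_fun setT f ->
  measurable_fun setT (fun t => (f t)^-1).
Proof.
move=> mf.
(* [powR] with exponent -1 is identified with the inverse on nonnegative reals, hence the square; at
   a zero of [f] both sides are 0. *)
rewrite (_ : (fun _ => _) = (fun t => f t * (f t ^+ 2) `^ (-1))).
  apply: measurable_funM => //.
  apply: (@measurableT_comp _ _ _ _ _ _ (fun y : R => y `^ (-1))).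
    exact: measurable_powR.
  exact: measurable_funX.
apply/funext => t; rewrite powR_inv1 ?sqr_ge0//.
have [->|f0] := eqVneq (f t) 0; first by rewrite mul0r invr0.
by field.
Qed.

Definition measurable_mx m n (F : T -> 'M[R]_(m, n)) :=
  forall i j, measurable_fun setT (fun t => F t i j).

Lemma measurable_mx_cst m n (A : 'M[R]_(m, n)) : measurable_mx (fun=> A).
Proof. by move=> i j. Qed.

Lemma measurable_mxB m n (F G : T -> 'M[R]_(m, n)) :
  measurable_mx F -> measurable_mx G -> measurable_mx (fun t => F t - G t).
Proof.
move=> mF mG i j; under eq_fun do rewrite !mxE.
exact: measurable_funB.
Qed.

Lemma measurable_mxZ m n (f : T -> R) (G : T -> 'M[R]_(m, n)) :
  measurable_fun setT f -> measurable_mx G -> measurable_mx (fun t => f t *: G t).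
Proof.
move=> mf mG i j; under eq_fun do rewrite !mxE.
exact: measurable_funM.
Qed.

Lemma measurable_mx_tr m n (F : T -> 'M[R]_(m, n)) :
  measurable_mx F -> measurable_mx (fun t => (F t)^T).
Proof. by move=> mF i j; under eq_fun do rewrite !mxE; exact: mF. Qed.

Lemma measurable_mxM m n p (F : T -> 'M[R]_(m, n)) (G : T -> 'M[R]_(n, p)) :
  measurable_mx F -> measurable_mx G -> measurable_mx (fun t => F t *m G t).
Proof.
move=> mF mG i j; under eq_fun do rewrite !mxE.
by apply: measurable_sum => k; exact: measurable_funM.
Qed.

Lemma measurable_dotv m (F G : T -> 'cV[R]_m) :
  measurable_mx F -> measurable_mx G -> measurable_fun setT (fun t => dotv (F t) (G t)).
Proof.
move=> mF mG; apply: (measurable_mxM (F := fun t => (F t)^T)) => //.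
exact: measurable_mx_tr.
Qed.

Lemma measurable_mxtrace m (F : T -> 'M[R]_m) :
  measurable_mx F -> measurable_fun setT (fun t => \tr (F t)).
Proof. by move=> mF; apply: measurable_sum => i; exact: mF. Qed.

Lemma measurable_defl m (F : T -> 'M[R]_m) (G : T -> 'cV[R]_m) :
  measurable_mx F -> measurable_mx G -> measurable_mx (fun t => defl (F t) (G t)).
Proof.
move=> mF mG; have mFG := measurable_mxM mF mG.
apply: measurable_mxB => //; apply: measurable_mxZ.
  by apply: measurable_funVr; exact: measurable_dotv.
by apply: measurable_mxM => //; exact: measurable_mx_tr.
Qed.

End measurable_matrix.

(** * Deflating a fixed projection by a Gaussian vector *)

Section gaussian_deflation.
Context {R : realType} d (T : measurableType d) (P : probability T R) (m : nat).
Variable Z : T -> 'cV[R]_m.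
Hypothesis gZ : std_gaussian_vec P Z.

Lemma measurable_std_gaussian : measurable_mx Z.
Proof. by move=> i j; rewrite ord1; exact: gZ.1. Qed.
Let mZ := measurable_std_gaussian.

Let proj_sqsum (Q : 'M[R]_m) us t : is_proj Q -> Q = \sum_(u <- us) u *m u^T ->
  dotv (Q *m Z t) (Q *m Z t) = sqsum Z us t.
Proof.
move=> pQ QE; rewrite proj_dotv// QE mulmx_suml /sqsum.
elim: us {QE} => [|u us IH]; first by rewrite !big_nil dotv0l.
by rewrite !big_cons dotvDl IH outer_mulmx dotvZl expr2.
Qed.

(** [|Q Z|^2] dominates [(u . Z)^2] for a unit vector [u] in the range of [Q], and the law [N(0,1)]
    of [u . Z] has no atom at 0. *)
Lemma std_gaussian_proj_neq0 (Q : 'M[R]_m) : is_proj Q -> 0 < \tr Q ->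
  measurable [set t | Q *m Z t = 0] /\ P [set t | Q *m Z t = 0] = 0%E.
Proof.
move=> pQ; have [us [ous QE ->]] := proj_orthonormal pQ => us0.
have E : [set t | Q *m Z t = 0] = (sqsum Z us) @^-1` [set 0].
  apply/seteqP; split => t /=; first by rewrite -(proj_sqsum t pQ QE) => ->; rewrite dotv0l.
  by rewrite -(proj_sqsum t pQ QE) => /eqP; rewrite dotvv_eq0 => /eqP.
have ms := measurable_sqsum gZ us.
have mE : measurable [set t | Q *m Z t = 0].
  by rewrite E -[X in measurable X]setTI; exact: ms.
split=> //; case: us us0 ous QE E ms => [|u us]; first by rewrite ltxx.
move=> _ ous QE E ms.
have mN : measurable ((fun t => dotv u (Z t)) @^-1` [set 0]).
  rewrite -[X in measurable X]setTI.
  exact: (measurable_dotv_std_gaussian gZ u).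
apply/eqP; rewrite eq_le measure_ge0 andbT.
have uu : dotv u u = 1 by case: ous.
have <- : P ((fun t => dotv u (Z t)) @^-1` [set 0]) = 0%E.
  by rewrite gZ.2// /normal_prob integral_set1.
apply: le_measure; rewrite ?inE// E => t /= q0.
have : dotv u (Z t) ^+ 2 <= 0 by rewrite -q0 sqsum_ge// mem_head.
by rewrite real_exprn_even_le0//= ?num_real// => /eqP.
Qed.

(** Take an orthonormal basis [u :: us] of the range of [Q] with [u] along [Q v], and let
    [k = Tr Q]. Almost surely [|defl Q Z v|^2] is [|Q v|^2] times [1 - (u . Z)^2 / |Q Z|^2]. Ratios
    are bounded only from above, so this difference is rewritten as the sum of the [k - 1] ratios
    for [us], each of expectation at most [1/k]; division by the new trace [k - 1] leaves
    [|Q v|^2 / k]. *)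
Lemma integral_defl_le (Q : 'M[R]_m) v : is_proj Q -> 1 < \tr Q ->
  (\int[P]_t (dotv (defl Q (Z t) *m v) (defl Q (Z t) *m v) / \tr (defl Q (Z t)))%:E
   <= (dotv (Q *m v) (Q *m v) / \tr Q)%:E)%E.
Proof.
move=> pQ trQ1.
have [Qv0|Qv0] := eqVneq (Q *m v) 0.
  rewrite integral0_eq ?Qv0 ?dotv0l ?mul0r// => t _.
  by rewrite (defl_mul0 _ pQ Qv0) dotv0l mul0r.
have [u [us [ous QE tQ Qv]]] := proj_orthonormal_cons pQ Qv0.
set r := Num.sqrt _ in Qv.
have rr : r ^+ 2 = dotv (Q *m v) (Q *m v) by rewrite sqr_sqrtr// dotvv_ge0.
have trQ0 : 0 < \tr Q by rewrite (lt_trans ltr01).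
have [mN PN] := std_gaussian_proj_neq0 pQ trQ0.
have k0 : 0 < (size us)%:R :> R by move: trQ1; rewrite tQ /= -natr1 ltrDr.
pose h t := \sum_(w <- us) dotv w (Z t) ^+ 2 / sqsum Z (u :: us) t.
have msr w : measurable_fun setT (fun t => dotv w (Z t) ^+ 2 / sqsum Z (u :: us) t).
  apply: measurable_funM.
    by apply: measurable_funX; exact: (measurable_dotv_std_gaussian gZ).
  by apply: measurable_funVr; exact: (measurable_sqsum gZ).
have sr0 w t : 0 <= dotv w (Z t) ^+ 2 / sqsum Z (u :: us) t.
  by rewrite divr_ge0 ?sqr_ge0 ?sqsum_ge0.
have mh : measurable_fun setT h by exact: measurable_sum.
have h0 t : 0 <= h t by apply: sumr_ge0.
have mD : measurable_mx (fun t => defl Q (Z t)).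
  by apply: measurable_defl => //; exact: measurable_mx_cst.
have mDv : measurable_mx (fun t => defl Q (Z t) *m v).
  by apply: measurable_mxM => //; exact: measurable_mx_cst.
apply: (@le_trans _ _ (\int[P]_t ((r ^+ 2 / (size us)%:R)%:E * (h t)%:E))%E).
  apply: ae_ge0_le_integral => //.
  - move=> t _; rewrite lee_fin divr_ge0 ?dotvv_ge0//.
    rewrite mxtrace_defl subr_ge0 (le_trans _ (ltW trQ1))//.
    by case: (_ != _).
  - apply/measurable_EFinP; apply: measurable_funM; first exact: measurable_dotv.
    by apply: measurable_funVr; exact: measurable_mxtrace.
  - by move=> t _; rewrite -EFinM lee_fin mulr_ge0// divr_ge0 ?sqr_ge0 ?ltW.
  - by apply: emeasurable_funM => //; exact/measurable_EFinP.
  - exists [set t | Q *m Z t = 0]; split => // t /=.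
    apply: contra_notP => /eqP yt _; rewrite -EFinM lee_fin.
    rewrite dotv_defl// (proj_sqsum t pQ QE) mxtrace_defl yt tQ /= -natr1 addrK.
    have -> : dotv (Q *m v) (Z t) = r * dotv u (Z t) by rewrite Qv dotvZl.
    rewrite -rr exprMn [leRHS]mulrAC ler_wpM2r ?invr_ge0 ?(ltW k0)//.
    have q0 : sqsum Z (u :: us) t != 0.
      by rewrite -(proj_sqsum t pQ QE) dotvv_eq0.
    rewrite -mulrA -[X in X - _]mulr1 -mulrBr ler_wpM2l ?sqr_ge0//.
    rewrite le_eqVlt; apply/orP; left; apply/eqP.
    rewrite /h -mulr_suml -[X in X - _](divff q0) -mulrBl; congr (_ / _).
    by rewrite /sqsum big_cons addrAC subrr add0r.
rewrite ge0_integralZl//; last 3 first.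
- exact/measurable_EFinP.
- by move=> t _; rewrite lee_fin.
- by rewrite lee_fin divr_ge0 ?sqr_ge0 ?ltW.
rewrite /h; under eq_integral do rewrite -sumEFin.
rewrite ge0_integral_sum//; last first.
- by move=> w t _; rewrite lee_fin.
- by move=> w; exact/measurable_EFinP.
apply: (@le_trans _ _ ((r ^+ 2 / (size us)%:R)%:E * ((size us)%:R / \tr Q)%:E)%E).
  apply: lee_wpmul2l; first by rewrite lee_fin divr_ge0 ?sqr_ge0 ?ltW.
  have -> : ((size us)%:R / \tr Q)%:E = (\sum_(w <- us) ((\tr Q)^-1)%:E)%E.
    by rewrite sumEFin big_const_seq count_predT iter_addr_0 mulr_natl.
  rewrite big_seq_cond [leRHS]big_seq_cond; apply: lee_sum => w /andP[wus _].
  by rewrite tQ; apply: integral_sq_ratio_le => //; rewrite inE wus orbT.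
rewrite -EFinM lee_fin -rr mulrA divfK ?gt_eqF//.
Qed.

(** The integrand is [(v . w)^2] for the dual vector [w = y / |y|^2], [y = Q Z]. Taking the first
    basis vector [u] along [Q v] turns [v . y] into a multiple of [u . Z]. *)
Lemma integral_inv_sq_le (Q : 'M[R]_m) v : is_proj Q -> 2 < \tr Q ->
  (\int[P]_t (dotv v (Q *m Z t) ^+ 2 / dotv (Q *m Z t) (Q *m Z t) ^+ 2)%:E
   <= (dotv (Q *m v) (Q *m v) / (\tr Q * (\tr Q - 2)))%:E)%E.
Proof.
move=> pQ trQ2; have QT := pQ.1.
have vE t : dotv v (Q *m Z t) = dotv (Q *m v) (Z t) by rewrite dotv_mull QT.
have [Qv0|Qv0] := eqVneq (Q *m v) 0.
  rewrite integral0_eq ?Qv0 ?dotv0l ?mul0r// => t _.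
  by rewrite vE Qv0 dotv0l expr0n mul0r.
have [u [us [ous QE tQ Qv]]] := proj_orthonormal_cons pQ Qv0.
set r := Num.sqrt _ in Qv.
have rr : r ^+ 2 = dotv (Q *m v) (Q *m v) by rewrite sqr_sqrtr// dotvv_ge0.
under eq_integral do rewrite vE Qv dotvZl exprMn (proj_sqsum _ pQ QE) -mulrA EFinM.
rewrite ge0_integralZl//; last 3 first.
- apply/measurable_EFinP; apply: measurable_funM.
    by apply: measurable_funX; exact: (measurable_dotv_std_gaussian gZ).
  by apply: measurable_funVr; apply: measurable_funX; exact: (measurable_sqsum gZ).
- by move=> t _; rewrite lee_fin divr_ge0 ?sqr_ge0.
- by rewrite lee_fin sqr_ge0.
rewrite -rr [leRHS]EFinM; apply: lee_wpmul2l; first by rewrite lee_fin sqr_ge0.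
rewrite tQ; apply: integral_sq_ratio2_le => //; first exact: mem_head.
by move: trQ2; rewrite tQ ltr_nat.
Qed.

End gaussian_deflation.

(** * Independent samples *)

Section decoupling.
Context {R : realType} dT (T : measurableType dT) (P : probability T R) (n d : nat).
Variable X : 'I_n -> T -> 'cV[R]_d.
Hypothesis mX : forall i, rvec_measurable (X i).
Hypothesis iX : mutually_independent P X.

Definition box (B : 'I_n -> 'I_d -> set R) : set 'M[R]_(d, n) :=
  [set w | forall i j, B i j (w j i)].

Definition boxes : set (set 'M[R]_(d, n)) :=
  [set A | exists2 B, forall i j, measurable (B i j) & A = box B].

(** Matrices get the sigma-algebra generated by the boxes, the pi-system on which independence is
    assumed; two laws of samples then agree once they agree on boxes. *)
Definition sample_type := g_sigma_algebraType boxes.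

Let boxesI : setI_closed boxes.
Proof.
move=> _ _ [B mB ->] [C mC ->]; exists (fun i j => B i j `&` C i j).
  by move=> i j; exact: measurableI.
apply/seteqP; split => w /=; first by move=> [wB wC] i j; split; [exact: wB|exact: wC].
by move=> wBC; split => i j; have [] := wBC i j.
Qed.

Let boxesT : boxes setT.
Proof.
exists (fun _ _ => setT); first by [].
by apply/seteqP; split.
Qed.

Lemma measurable_sample_coord i j :
  measurable_fun [set: sample_type] (fun w : sample_type => (w : 'M[R]_(d, n)) j i).
Proof.
move=> _ C mC; rewrite setTI; apply: sub_sigma_algebra.
exists (fun i' j' => if (i' == i) && (j' == j) then C else setT).
  by move=> i' j'; case: ifP.
apply/seteqP; split => w /=; last by move=> /(_ i j); rewrite !eqxx.
by move=> Cw i' j'; case: ifPn => // /andP[/eqP -> /eqP ->].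
Qed.

Let bigcap_ord_measurable d' (U : measurableType d') (p : nat) (F : 'I_p -> set U) :
  (forall i, measurable (F i)) -> measurable (\bigcap_i F i).
Proof. by move=> mF; apply: fin_bigcap_measurable => // i _; exact: mF. Qed.

Lemma measurable_to_sample d' (U : measurableType d') (f : U -> 'M[R]_(d, n)) :
  (forall i j, measurable_fun setT (fun u => f u j i)) ->
  measurable_fun [set: U] (f : U -> sample_type).
Proof.
move=> mf; apply: (@measurability _ _ U sample_type setT f boxes erefl) => _ [_ [B mB ->] <-].
rewrite setTI.
have -> : f @^-1` box B = \bigcap_i \bigcap_j ((fun u => f u j i) @^-1` B i j).
  apply/seteqP; split => u /=; first by move=> h i _ j _; exact: h.
  by move=> h i j; exact: h.
apply: bigcap_ord_measurable => i; apply: bigcap_ord_measurable => j.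
by rewrite -[X in measurable X]setTI; exact: mf.
Qed.

Definition sample (t : T) : sample_type := \matrix_(j, i) X i t j 0.

Definition mixed_sample i (z : T * T) : sample_type :=
  \matrix_(j, k) (if k == i then X k z.1 j 0 else X k z.2 j 0).

Lemma measurable_sample : measurable_fun setT sample.
Proof.
apply: measurable_to_sample => i j; under eq_fun do rewrite mxE.
exact: mX.
Qed.

Lemma measurable_mixed_sample i : measurable_fun setT (mixed_sample i).
Proof.
apply: measurable_to_sample => k j; under eq_fun do rewrite mxE.
case: (k == i).
  exact: (measurableT_comp (mX k j) measurable_fst).
exact: (measurableT_comp (mX k j) measurable_snd).
Qed.

(* Independence as resampling: replacing [X i] by an independent copy does not
   change the joint law. *)
Let mixed_sample_law i (A : set sample_type) : measurable A ->
  pushforward P sample A = pushforward (P \x P)%E (mixed_sample i) A.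
Proof.
have ms := measurable_sample; have mm := measurable_mixed_sample i.
apply: (@measure_unique _ R sample_type boxes (fun=> setT) erefl boxesI
  (fun=> boxesT) _ (pushforward P sample)
  (pushforward (P \x P)%E (mixed_sample i))) => //.
- exact: bigcup_const.
- move=> _ [B mB ->].
  change (P (sample @^-1` box B) = (P \x P)%E (mixed_sample i @^-1` box B)).
  pose C k := \bigcap_(j : 'I_d) ((fun t => X k t j ord0) @^-1` B k j).
  have mC k : measurable (C k).
    apply: bigcap_ord_measurable => j; rewrite -[X in measurable X]setTI.
    exact: mX.
  have -> : sample @^-1` box B = \bigcap_(k in [set k | k \in [set: 'I_n]%SET]) C k.
    apply/seteqP; split => t /=.
      by move=> h k _ j _; have := h k j; rewrite mxE.
    by move=> h k j; rewrite mxE; apply: (h k) => //=; rewrite inE.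
  have -> : mixed_sample i @^-1` box B =
      C i `*` \bigcap_(k in [set k | k \in (~: [set i])%SET]) C k.
    apply/seteqP; split => -[t1 t2] /=.
      move=> h; split.
        by move=> j _; have := h i j; rewrite mxE eqxx.
      move=> k /=; rewrite !inE => /negbTE ki j _.
      by have := h k j; rewrite mxE ki.
    move=> [h1 h2] k j; rewrite mxE; case: eqVneq => [->|ki]; first exact: h1.
    by apply: (h2 k) => //=; rewrite !inE.
  have mCi : measurable (\bigcap_(k in [set k | k \in (~: [set i])%SET]) C k).
    by apply: fin_bigcap_measurable => // k _; exact: mC.
  (* Independence is used twice, for all columns and for those other than [i]; the product measure
     supplies the factor of column [i]. *)
  rewrite product_measure1E// iX// (bigD1 i) ?inE//= [in RHS]iX//.
  apply: (congr1 (fun x => P (C i) * x)%E).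
  by apply: eq_bigl => k; rewrite !inE.
- move=> _; rewrite [X in (X < _)%E](_ : _ = 1%E) ?ltry//.
  exact: (probability_setT P).
Qed.

(** This stands in for conditioning on the [X k] with [k != i]: the inner integral runs over a fresh
    [X i] while the other columns are frozen at [t]. *)
Lemma sample_integralE i (f : sample_type -> \bar R) : measurable_fun setT f ->
  (forall w, 0 <= f w)%E ->
  (\int[P]_t f (sample t) = \int[P]_t \int[P]_s f (mixed_sample i (s, t)))%E.
Proof.
move=> mf f0.
have ms := measurable_sample; have mm := measurable_mixed_sample i.
have -> : (\int[P]_t f (sample t) = \int[pushforward P sample]_w f w)%E.
  by rewrite ge0_integral_pushforward.
transitivity (\int[pushforward (P \x P)%E (mixed_sample i)]_w f w)%E.
  by apply: eq_measure_integral => A mA _; exact: mixed_sample_law.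
rewrite ge0_integral_pushforward//= (fubini_tonelli2 (fun z => f (mixed_sample i z)))//.
exact: measurableT_comp.
Qed.

Lemma sample_integral_le i (f g : sample_type -> \bar R) :
  measurable_fun setT f -> (forall w, 0 <= f w)%E ->
  measurable_fun setT g ->
  (forall t, \int[P]_s f (mixed_sample i (s, t)) <= g (sample t))%E ->
  (\int[P]_t f (sample t) <= \int[P]_t g (sample t))%E.
Proof.
move=> mf f0 mg fg; rewrite (sample_integralE i)//.
apply: ge0_le_integral => //.
- by move=> t _; exact: integral_ge0.
- apply: (measurable_fun_fubini_tonelli_G (fun z => f (mixed_sample i z))) => //.
  by apply: measurableT_comp => //; exact: measurable_mixed_sample.
- by apply: measurableT_comp => //; exact: measurable_sample.
Qed.

End decoupling.

(** * Whitening, residuals and the expected trace *)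

Section scatter_bound.
Context {R : realType}.

Lemma posdef_factor d (S : 'M[R]_d) : posdef S ->
  exists2 A : 'M[R]_d, A \in unitmx & S = A *m A^T.
Proof.
move=> [ST Spos].
have [A SA] : exists A : 'M[R]_d, S = A *m A^T.
  apply: cholesky => // x; have [->|x0] := eqVneq x 0.
    by rewrite mulmx0 dotv0l.
  by rewrite /dotv mulmxA ltW// Spos.
exists A => //; rewrite -row_free_unit -kermx_eq0.
apply: contraT => /rowV0Pn[v /sub_kermxP vA v0].
have vT0 : v^T != 0 by rewrite -(inj_eq (can_inj (@trmxK _ _ _))) trmxK trmx0.
by have := Spos _ vT0; rewrite trmxK SA mulmxA vA !mul0mx mxE ltxx.
Qed.

Lemma invmx_mul_tr d (A : 'M[R]_d) : A \in unitmx ->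
  invmx (A *m A^T) = (invmx A)^T *m invmx A.
Proof.
move=> uA; have uS : A *m A^T \in unitmx by rewrite unitmx_mul uA unitmx_tr.
rewrite -[RHS]mulmx1 -(mulmxV uS) !mulmxA.
rewrite -(mulmxA _ (invmx A)) mulVmx// mulmx1.
by rewrite -(trmx_mul A) mulmxV// trmx1 mul1mx.
Qed.

Lemma std_gaussian_whitening dT (T : measurableType dT) (P : probability T R) d
    (X : T -> 'cV[R]_d) (A : 'M[R]_d) : A \in unitmx ->
  rvec_measurable X -> gaussian_vec P X (A *m A^T) ->
  std_gaussian_vec P (fun t => invmx A *m X t).
Proof.
move=> uA mX gX; split.
  have mX' : measurable_mx X by move=> i j; rewrite ord1; exact: mX.
  by move=> j; apply: (measurable_mxM (F := fun=> invmx A)) => //; exact: measurable_mx_cst.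
move=> u uu B mB; set a := (invmx A)^T *m u.
have a0 : a != 0.
  apply/eqP => /(congr1 (mulmx A^T)); rewrite /a mulmxA -trmx_mul mulVmx// trmx1.
  rewrite mul1mx mulmx0 => u0; move: uu; rewrite u0 dotv0l => /eqP.
  by rewrite eq_sym oner_eq0.
have := gX a a0 B mB.
have -> : (a^T *m (A *m A^T) *m a) ord0 ord0 = 1.
  rewrite -uu /dotv /a trmx_mul trmxK !mulmxA -(mulmxA u^T) mulVmx// mulmx1.
  by rewrite -(mulmxA u^T) -trmx_mul mulVmx// trmx1 mulmx1.
rewrite sqrtr1 => <-; congr (P _); apply/funext => t /=.
by rewrite dotvC dotv_mull dotvC.
Qed.

Import HBNNSimple.

(** Measurability is asked of [g] only, since [f] will be the trace of [mp_pinv], which is defined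
    by choice. The integral of [f] is the supremum over the simple functions below [f], and each of
    these is almost everywhere below [g]. *)
Lemma ae_le_integral_ge0 dT (T : measurableType dT) (P : probability T R)
    (f g : T -> \bar R) : (forall t, 0 <= f t)%E -> (forall t, 0 <= g t)%E ->
  measurable_fun setT g -> {ae P, forall t, (f t <= g t)%E} ->
  (\int[P]_t f t <= \int[P]_t g t)%E.
Proof.
move=> f0 g0 mg fg; rewrite ge0_integralTE//; apply: ge_ereal_sup => _ [h /= hf <-].
rewrite -integralT_nnsfun; apply: ae_ge0_le_integral => //.
- by move=> t _; rewrite lee_fin; exact: fun_ge0.
- exact/measurable_EFinP.
- by apply: filterS fg => t fgt _; exact: le_trans (hf t) fgt.
Qed.

Context dT (T : measurableType dT) (P : probability T R) (n d : nat).
Variables (A : 'M[R]_d) (X : 'I_n -> T -> 'cV[R]_d).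
Hypothesis uA : A \in unitmx.
Hypothesis mX : forall i, rvec_measurable (X i).
Hypothesis gX : forall i, gaussian_vec P (X i) (A *m A^T).
Hypothesis iX : mutually_independent P X.
Hypothesis nd : (n.+1 < d)%N.
Notation Omega := (@sample_type R n d).

Definition white (w : 'M[R]_(d, n)) i : 'cV[R]_d := invmx A *m col i w.
Definition rproj (w : 'M[R]_(d, n)) (js : seq 'I_n) : 'M[R]_d :=
  defls [seq white w k | k <- js].

Let measurable_white i : measurable_mx (fun w : Omega => white w i).
Proof.
apply: measurable_mxM; first exact: measurable_mx_cst.
by move=> j k; under eq_fun do rewrite mxE; exact: measurable_sample_coord.
Qed.

Let measurable_rproj js : measurable_mx (fun w : Omega => rproj w js).
Proof.
elim: js => [|j js IH]; first exact: measurable_mx_cst.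
by apply: measurable_defl => //; exact: measurable_white.
Qed.

Let white_mixed i s t : white (mixed_sample X i (s, t)) i = invmx A *m X i s.
Proof. by congr (_ *m _); apply/matrixP => j k; rewrite !mxE eqxx ord1. Qed.

Let rproj_mixed i s t js : i \notin js ->
  rproj (mixed_sample X i (s, t)) js = rproj (sample X t) js.
Proof.
move=> ijs; congr defls; apply/eq_in_map => k kjs.
congr (_ *m _); apply/matrixP => j l; rewrite !mxE ifF//.
by apply/negbTE; apply: contra ijs => /eqP <-.
Qed.

Let is_proj_rproj w js : is_proj (rproj w js).
Proof. exact: is_proj_defls. Qed.

Let mxtrace_rproj_ge w js : d%:R - (size js)%:R <= \tr (rproj w js).
Proof. by rewrite /rproj -(size_map (white w)); exact: mxtrace_defls_ge. Qed.

Let gZ i := std_gaussian_whitening uA (mX i) (gX i).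

(** With [js] among the columns other than a given one, this yields [Tr Q - 2 >= d - n - 1], the
    denominator of the final bound. *)
Let mxtrace_rproj_gt w js : (size js < n)%N -> d%:R - n%:R + 1 <= \tr (rproj w js).
Proof.
move=> jsn; apply: le_trans (mxtrace_rproj_ge w js).
have : (size js)%:R + 1 <= n%:R :> R by rewrite natr1 ler_nat.
lra.
Qed.

Let dn1 : 0 < d%:R - n%:R - 1 :> R.
Proof. by rewrite -addrA -opprD subr_gt0 natr1 ltr_nat. Qed.

Let h js v (w : Omega) : R := dotv (rproj w js *m v) (rproj w js *m v) / \tr (rproj w js).

Let measurable_h js v : measurable_fun setT (h js v).
Proof.
have mv : measurable_mx (fun w : Omega => rproj w js *m v).
  by apply: measurable_mxM => //; exact: measurable_mx_cst.
apply: measurable_funM; first exact: measurable_dotv.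
by apply: measurable_funVr; exact: measurable_mxtrace.
Qed.

Let tr_rproj_ge0 w js : 0 <= \tr (rproj w js).
Proof.
have [QT QQ] := is_proj_rproj w js.
by rewrite -QQ -[X in _ *m X]QT mxtrace_mul_tr_ge0.
Qed.

Let h_ge0 js v w : 0 <= h js v w.
Proof. by rewrite divr_ge0 ?dotvv_ge0. Qed.

(* Along the successive projections, [|P_k v|^2 / Tr P_k] is a (super)martingale. *)
Let integral_h_le js v : uniq js -> (size js <= n)%N ->
  (\int[P]_t (h js v (sample X t))%:E <= (dotv v v / d%:R)%:E)%E.
Proof.
elim: js => [_ _|j js IH /= /andP[jjs ujs] jsn].
  rewrite /h /rproj /= mul1mx mxtrace1.
  rewrite integral_cst// [X in (_ * X)%E](_ : _ = 1%E) ?mule1//.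
  exact: probability_setT.
apply: le_trans (IH ujs (ltnW jsn)).
apply: (sample_integral_le mX iX (i := j)
  (f := fun w => (h (j :: js) v w)%:E) (g := fun w => (h js v w)%:E)) => //.
- by apply/measurable_EFinP; exact: measurable_h.
- by move=> w; rewrite lee_fin.
- by apply/measurable_EFinP; exact: measurable_h.
move=> t; rewrite /h /rproj /=.
under eq_integral do rewrite -/(rproj _ js) rproj_mixed// white_mixed.
rewrite -/(rproj _ js).
apply: (integral_defl_le (gZ j)) => //.
apply: lt_le_trans (mxtrace_rproj_gt _ jsn).
by move: dn1; lra.
Qed.

Let others i := rem i (enum 'I_n).

Let others_spec i : [/\ uniq (others i), (size (others i) < n)%N &
  forall k, (k \in others i) = (k != i)].
Proof.
have u := enum_uniq 'I_n; split; first exact: rem_uniq.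
  by rewrite size_rem ?mem_enum// size_enum_ord prednK// (leq_ltn_trans _ (ltn_ord i)).
by move=> k; rewrite mem_rem_uniq// inE mem_enum andbT.
Qed.

Let resid i (w : Omega) : 'cV[R]_d := rproj w (others i) *m white w i.

Let measurable_resid i : measurable_mx (resid i).
Proof. exact: measurable_mxM. Qed.

(** Resampling [X i] with the other columns frozen gives [|Q v|^2 / (k (k - 2))], [k = Tr Q]. Of the
    two factors only [k - 2] is replaced by [d - n - 1]; what remains is [h (others i) v], whose
    expectation is controlled along the successive projections. *)
Let integral_resid_le i v :
  (\int[P]_t (dotv v (resid i (sample X t)) ^+ 2 /
     dotv (resid i (sample X t)) (resid i (sample X t)) ^+ 2)%:E
   <= (dotv v v / d%:R / (d%:R - n%:R - 1))%:E)%E.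
Proof.
have [uo so mo] := others_spec i.
apply: (@le_trans _ _ (\int[P]_t ((d%:R - n%:R - 1)^-1%:E * (h (others i) v (sample X t))%:E)))%E.
  apply: (sample_integral_le mX iX (i := i)
    (f := fun w => (dotv v (resid i w) ^+ 2 / dotv (resid i w) (resid i w) ^+ 2)%:E)
    (g := fun w => ((d%:R - n%:R - 1)^-1%:E * (h (others i) v w)%:E)%E)).
  - apply/measurable_EFinP; apply: measurable_funM.
      by apply: measurable_funX; apply: measurable_dotv => //; exact: measurable_mx_cst.
    by apply: measurable_funVr; apply: measurable_funX; exact: measurable_dotv.
  - by move=> w; rewrite lee_fin divr_ge0 ?sqr_ge0.
  - by apply: emeasurable_funM => //; apply/measurable_EFinP; exact: measurable_h.
  move=> t; rewrite /resid.
  under eq_integral do rewrite rproj_mixed ?mo ?eqxx// white_mixed.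
  have trQ := mxtrace_rproj_gt (sample X t) so.
  set Q := rproj _ _ in trQ *.
  have trQ2 : 2 < \tr Q by move: dn1 trQ; lra.
  apply: le_trans (integral_inv_sq_le (gZ i) v (is_proj_rproj _ _) trQ2) _.
  rewrite -EFinM lee_fin /h -/Q invfM mulrA mulrC ler_wpM2r//.
    by rewrite divr_ge0 ?dotvv_ge0// (le_trans _ (ltW trQ2)).
  rewrite lef_pV2 ?posrE//; last by rewrite subr_gt0.
  by move: trQ; lra.
rewrite ge0_integralZl//; last 3 first.
- apply/measurable_EFinP; apply: measurableT_comp => //.
  exact: measurable_sample.
- by move=> t _; rewrite lee_fin.
- by rewrite lee_fin invr_ge0 ltW.
rewrite mulrC EFinM; apply: lee_wpmul2l.
  by rewrite lee_fin invr_ge0 ltW.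
by apply: integral_h_le => //; exact: ltnW.
Qed.

(** With the other columns frozen, [resid i] is [Q Z_i] with [Tr Q > 0], which vanishes with
    probability 0. Applying [sample_integral_le] to the indicator of the event, with bound 0,
    removes the freezing. *)
Let resid_neq0 i : {ae P, forall t, resid i (sample X t) != 0}.
Proof.
have [uo so mo] := others_spec i.
pose N : set Omega := [set w | resid i w = 0].
have mN : measurable N.
  have -> : N = (fun w => dotv (resid i w) (resid i w)) @^-1` [set 0].
    apply/seteqP; split => w /=; first by rewrite /N /= => ->; rewrite dotv0l.
    by move=> /eqP; rewrite dotvv_eq0 => /eqP.
  by rewrite -[X in measurable X]setTI; exact: (measurable_dotv (measurable_resid i)).
have mNs : measurable (sample X @^-1` N).
  by rewrite -[X in measurable X]setTI; exact: measurable_sample.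
exists (sample X @^-1` N); split => //; last first.
  by move=> t /= /negP; rewrite negbK => /eqP.
apply/eqP; rewrite eq_le measure_ge0 andbT.
rewrite -[X in P X]setIT -(integral_indic P measurableT mNs).
have -> : 0%E = (\int[P]_t (fun=> 0) (sample X t))%E by rewrite integral0.
apply: (sample_integral_le mX iX (i := i)
  (f := fun w => (\1_N w)%:E) (g := fun=> 0%E)) => //.
- by apply/measurable_EFinP; exact: measurable_indic.
move=> t; have trQ := mxtrace_rproj_gt (sample X t) so.
have trQ0 : 0 < \tr (rproj (sample X t) (others i)) by move: dn1 trQ; lra.
have [mE PE] := std_gaussian_proj_neq0 (gZ i) (is_proj_rproj _ _) trQ0.
rewrite -PE -[X in P X]setIT -(integral_indic P measurableT mE).
rewrite le_eqVlt; apply/orP; left; apply/eqP/eq_integral => s _; rewrite !indicE.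
congr ((_ : nat)%:R%:E); rewrite /N /resid; congr nat_of_bool.
apply/idP/idP; rewrite !inE /=; by rewrite rproj_mixed ?mo ?eqxx// white_mixed.
Qed.

Let left_inverse (w : Omega) : 'M[R]_(n, d) :=
  \matrix_(i, l) ((dotv (resid i w) (resid i w))^-1 * dotv (col l (invmx A)) (resid i w)).

Let left_inverseP (w : Omega) : (forall i, resid i w != 0) ->
  left_inverse w *m w = 1%:M.
Proof.
move=> w0; apply/matrixP => i k; rewrite !mxE.
have -> : \sum_j left_inverse w i j * w j k =
    (dotv (resid i w) (resid i w))^-1 * dotv (resid i w) (white w k).
  have -> : dotv (resid i w) (white w k) = dotv ((invmx A)^T *m resid i w) (col k w).
    by rewrite [RHS]dotv_mull trmxK.
  rewrite (dotvE ((invmx A)^T *m resid i w)) mulr_sumr; apply: eq_bigr => j _.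
  rewrite [left_inverse _ _ _]mxE [col _ _ _ _]mxE -mulrA; congr (_ * (_ * _)).
  by rewrite /dotv tr_col -row_mul [LHS]mxE.
have pQ := is_proj_rproj w (others i).
have [_ _ mo] := others_spec i.
have [->|ik] := eqVneq i k.
  have -> : dotv (resid k w) (white w k) = dotv (resid k w) (resid k w).
    by rewrite [RHS]proj_dotv.
  by rewrite mulVf// dotvv_eq0.
(* The symmetric projection [rproj] moves to the other factor, where it annihilates [white w k]. *)
rewrite [X in _ * X](_ : _ = 0) ?mulr0// /resid dotv_mull pQ.1.
rewrite /rproj defls_mul0 ?dotv0r//; apply: map_f.
by rewrite mo eq_sym.
Qed.

Let mxtrace_left_inverse w : \tr (left_inverse w *m (left_inverse w)^T) =
  \sum_i \sum_l (dotv (col l (invmx A)) (resid i w) ^+ 2 /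
     dotv (resid i w) (resid i w) ^+ 2).
Proof.
apply: eq_bigr => i _; rewrite mxE; apply: eq_bigr => l _.
by rewrite !mxE -expr2 exprMn exprVn mulrC.
Qed.

Let sum_col_invmx : \sum_l dotv (col l (invmx A)) (col l (invmx A)) =
  \tr (invmx (A *m A^T)).
Proof.
rewrite invmx_mul_tr//; apply: eq_bigr => l _.
rewrite mxE dotvE; apply: eq_bigr => i _.
by rewrite !mxE.
Qed.

Let scatter_sample t : scatter X t = (sample X t : 'M[R]_(d, n)) *m (sample X t : 'M[R]_(d, n))^T.
Proof.
apply/matrixP => i j; rewrite /scatter summxE mxE; apply: eq_bigr => k _.
by rewrite !mxE big_ord1 !mxE.
Qed.

Lemma integral_mxtrace_mp_pinv_scatter_le :
  (\int[P]_t (\tr (mp_pinv (scatter X t)))%:E <=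
    ((n%:R / d%:R) * (\tr (invmx (A *m A^T)) / (d%:R - n%:R - 1)))%:E)%E.
Proof.
pose F i l t : R := dotv (col l (invmx A)) (resid i (sample X t)) ^+ 2 /
     dotv (resid i (sample X t)) (resid i (sample X t)) ^+ 2.
have F0 i l t : 0 <= F i l t by rewrite divr_ge0 ?sqr_ge0.
have mr i : measurable_mx (fun t => resid i (sample X t)).
  move=> j k; apply: (measurableT_comp (measurable_resid i j k)).
  exact: measurable_sample.
have mF i l : measurable_fun setT (fun t => (F i l t)%:E).
  apply/measurable_EFinP; apply: measurable_funM.
    by apply: measurable_funX; apply: measurable_dotv => //; exact: measurable_mx_cst.
  by apply: measurable_funVr; apply: measurable_funX; exact: measurable_dotv.
apply: (@le_trans _ _ (\int[P]_t (\sum_i \sum_l (F i l t)%:E))%E).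
  apply: ae_le_integral_ge0.
  - by move=> t; rewrite lee_fin scatter_sample mxtrace_mp_pinv_ge0.
  - by move=> t; apply: sume_ge0 => i _; apply: sume_ge0 => l _; rewrite lee_fin.
  - by apply: emeasurable_sum => i; exact: emeasurable_sum.
  (* Outside a null set no residual vanishes, so [left_inverse] is a genuine left inverse of the
     sample and the trace comparison applies pointwise. *)
  - have : {ae P, forall t, forall i, resid i (sample X t) != 0}.
      by apply: filter_forall => i; exact: resid_neq0.
    apply: filterS => t wt.
    under eq_bigr do rewrite sumEFin.
    rewrite sumEFin lee_fin scatter_sample -mxtrace_left_inverse.
    exact/mxtrace_mp_pinv_le/left_inverseP.
rewrite ge0_integral_sum//; last 2 first.
- by move=> i; exact: emeasurable_sum.
- by move=> i t _; apply: sume_ge0 => l _; rewrite lee_fin.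
apply: (@le_trans _ _ (\sum_(i < n) \sum_(l < d) (dotv (col l (invmx A)) (col l (invmx A)) / d%:R /
     (d%:R - n%:R - 1))%:E)%E).
  apply: lee_sum => i _; rewrite ge0_integral_sum//; last first.
    by move=> l t _; rewrite lee_fin.
  by apply: lee_sum => l _; exact: integral_resid_le.
under eq_bigr do rewrite sumEFin -!mulr_suml sum_col_invmx.
rewrite sumEFin lee_fin sumr_const card_ord -mulr_natl.
by rewrite le_eqVlt; apply/orP; left; apply/eqP; ring.
Qed.

End scatter_bound.

Theorem theorem7 (R : realType) (dT : measure_display) (T : measurableType dT)
    (P : probability T R) (n d : nat) (Sigma : 'M[R]_d)
    (X : 'I_n -> T -> 'cV[R]_d) :
  posdef Sigma ->
  (forall i, rvec_measurable (X i)) ->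
  (forall i, gaussian_vec P (X i) Sigma) ->
  mutually_independent P X ->
  (n.+1 < d)%N ->
  (\int[P]_t (\tr (mp_pinv (scatter X t)))%:E <=
    ((n%:R / d%:R) * (\tr (invmx Sigma) / (d%:R - n%:R - 1)))%:E)%E.
Proof.
move=> pS mX gX iX nd; have [A uA SE] := posdef_factor pS.
by move: gX; rewrite SE => gX; exact: integral_mxtrace_mp_pinv_scatter_le.
Qed.
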